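(* Let $E$ be an interval effect algebra such that its state space $\mathcal S(E)$ is a simplex, and let $s$ be a state on $E$. Then there is a unique maximal regular Borel probability measure $\mu_s$ on $\mathcal B(\mathcal S(E))$ with $\mu_s\sim\delta_s$ such that $$s(a)=\int_{\mathcal S(E)}\hat a(x)\, d\mu_s(x),\qquad a\in E,$$ where $\hat a(x):=x(a)$ for $x\in\mathcal S(E)$ and $\delta_s$ is the Dirac measure concentrated at $s$.
   Context: An effect algebra is a partial algebra $(E;+,0,1)$ with a partially defined binary operation $+$ and constants $0,1$ such that for all $a,b,c\in E$: (i) $a+b$ is defined iff $b+a$ is defined, and then $a+b=b+a$; (ii) $a+b$ and $(a+b)+c$ are defined iff $b+c$ and $a+(b+c)$ are defined, and then $(a+b)+c=a+(b+c)$; (iii) for each $a\in E$ there is a unique $a'\in E$ with $a+a'=1$; (iv) if $a+1$ is defined then $a=0$. It is assumed throughout that $0\neq 1$. For an Abelian partially ordered group $G$ and $u\in G$, $u\ge 0$, put $\Gamma(G,u):=\{g\in G: 0\le g\le u\}$; with the restriction of the group addition (defined when the sum is still in $\Gamma(G,u)$) and with constants $0,u$ it is an effect algebra. An interval effect algebra is an effect algebra isomorphic to some $\Gamma(G,u)$. (A homomorphism of effect algebras preserves all existing sums and $1$; an isomorphism is a bijective homomorphism whose inverse is a homomorphism.) A state on $E$ is a mapping $s:E\to[0,1]$ with $s(1)=1$ and $s(a+b)=s(a)+s(b)$ whenever $a+b$ is defined. $\mathcal S(E)$ is the set of all states on $E$, a convex set, endowed with the topology of pointwise convergence on $E$ (a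 compact convex Hausdorff space, sitting in the locally convex space $\mathbb R^E$). Simplex: a convex cone in a real linear space $V$ is a subset $C$ containing $0$ and closed under linear combinations with nonnegative real coefficients; it is strict if $C\cap -C=\{0\}$; a strict cone defines a partial order $x\le_C y$ iff $y-x\in C$; a lattice cone is a strict convex cone $C$ that is a lattice under $\le_C$. A base for $C$ is a convex subset $K\subseteq C$ such that every nonzero $y\in C$ is uniquely of the form $y=\alpha x$ with $\alpha\in\mathbb R^+$, $x\in K$. A simplex is a convex subset of a linear space that is affinely isomorphic to a base for a lattice cone in some real linear space. Measures: let $K$ be a compact convex set in a locally convex Hausdorff space. A Borel measure $\mu$ on $K$ is regular if for every Borel set $Y$, $\mu(Y)=\inf\{\mu(O): Y\subseteq O,\ O \text{ open}\}=\sup\{\mu(C): C\subseteq Y,\ C\text{ closed}\}$. Write $\mu(f)=\int_K f\,d\mu$. $\mu\sim\lambda$ means $\mu(f)=\lambda(f)$ for all continuous affine $f:K\to\mathbb R$. For nonnegative regular Borel measures, $\mu\prec\lambda$ means $\mu(f)\le\lambda(f)$ for all continuous convex $f:K\to\mathbb R$; this is a partial order, and a regular Borel probability measure is maximal if it is maximal with respect to $\prec$. *)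

(* Defs.v *)
From HB Require Import structures.
From mathcomp Require Import all_boot all_order all_algebra.
From mathcomp Require Import interval_inference.
From mathcomp Require Import all_classical all_reals all_analysis.

Set Implicit Arguments.
Unset Strict Implicit.
Unset Printing Implicit Defensive.

Import Order.TTheory GRing.Theory Num.Theory.
Import numFieldNormedType.Exports.

Local Open Scope classical_set_scope.
Local Open Scope ring_scope.
Local Open Scope convex_scope.

(* [psum a b = None] encodes "a + b is not defined". *)
HB.mixin Record hasPartialSum E := {
  psum : E -> E -> option E ;
  pzero : E ;
  pone : E
}.

#[short(type="partialAlgType")]
HB.structure Definition PartialAlgebra := { E of Choice E & hasPartialSum E }.

(* In [psumA], [obind] makes either side [None] as soon as one of its two sums
   is undefined, so the equation says that the two sides are defined
   simultaneously, and then equal. *)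
HB.mixin Record PartialAlgebra_isEffectAlgebra E & PartialAlgebra E := {
  psumC : forall a b : E, psum a b = psum b a ;
  psumA : forall a b c : E,
    obind (fun x => psum x c) (psum a b) = obind (fun x => psum a x) (psum b c) ;
  porthoP : forall a : E, exists! a' : E, psum a a' = Some pone ;
  psum_pone : forall a : E, psum a pone <> None -> a = pzero ;
  pzero_neq_pone : (pzero : E) <> pone
}.

#[short(type="effectAlgType")]
HB.structure Definition EffectAlgebra :=
  { E of PartialAlgebra E & PartialAlgebra_isEffectAlgebra E }.

Definition pa_hom (E F : partialAlgType) (f : E -> F) : Prop :=
  (forall a b c : E, psum a b = Some c -> psum (f a) (f b) = Some (f c)) /\
  f pone = pone.

Definition pa_isomorphic (E F : partialAlgType) : Prop :=
  exists (f : E -> F) (g : F -> E),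
    [/\ pa_hom f, pa_hom g, cancel f g & cancel g f].

(* [porderZmodType] does not relate the order to the addition. *)
HB.mixin Record POrderedZmodule_isPoGroup G & Num.POrderedZmodule G := {
  pog_leD2r : forall z x y : G, x <= y -> x + z <= y + z
}.

#[short(type="poGroupType")]
HB.structure Definition PoGroup :=
  { G of Num.POrderedZmodule G & POrderedZmodule_isPoGroup G }.

Definition Gamma (G : poGroupType) (u : G) (u0 : 0 <= u) : Type :=
  {g : G | 0 <= g <= u}.

Section gamma.
Variables (G : poGroupType) (u : G) (u0 : 0 <= u).

HB.instance Definition _ := SubChoice.copy (Gamma u0) {g : G | 0 <= g <= u}.

Let Gamma_zero : Gamma u0.
Proof. by exists 0; rewrite lexx. Defined.

Let Gamma_one : Gamma u0.
Proof. by exists u; rewrite u0 lexx. Defined.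

HB.instance Definition _ := hasPartialSum.Build (Gamma u0)
  (fun a b => insub (\val a + \val b)) Gamma_zero Gamma_one.

End gamma.

Definition interval_effect_algebra (E : effectAlgType) : Prop :=
  exists (G : poGroupType) (u : G) (u0 : 0 <= u), pa_isomorphic E (Gamma u0).

Definition is_state (R : realType) (E : effectAlgType) (s : E -> R) : Prop :=
  [/\ forall a, 0 <= s a <= 1,
      s pone = 1 &
      forall a b c, psum a b = Some c -> s c = s a + s b].

HB.instance Definition _ (T : Type) (R : realType) :=
  GRing.Lmodule.copy {ptws T -> R^o} (T -> R^o).

Definition state_space (R : realType) (E : effectAlgType) :
  set {ptws E -> R^o} := [set s | is_state (s : E -> R)].
Arguments state_space : clear implicits.

Section simplex.
Variable R : realType.

Definition affine_on (V W : lmodType R) (K : set V) (f : V -> W) : Prop :=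
  forall t : {i01 R}, {in K &, forall x y : convex_lmodType V,
    f (x <| t |> y) = (f x : convex_lmodType W) <| t |> f y}.

Variable V : lmodType R.
Implicit Types (C K : set V) (x y z : V).

Definition convex_cone C : Prop :=
  C 0 /\ forall (a b : R) x y,
    0 <= a -> 0 <= b -> C x -> C y -> C (a *: x + b *: y).

Definition strict_cone C : Prop :=
  convex_cone C /\ C `&` [set - x | x in C] = [set 0].

Definition cone_le C x y : Prop := C (y - x).

Definition lattice_cone C : Prop :=
  strict_cone C /\ forall x y, C x -> C y ->
    (exists z, [/\ C z, cone_le C x z, cone_le C y z &
       forall w, C w -> cone_le C x w -> cone_le C y w -> cone_le C z w]) /\
    (exists z, [/\ C z, cone_le C z x, cone_le C z y &
       forall w, C w -> cone_le C w x -> cone_le C w y -> cone_le C w z]).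

Definition cone_base C K : Prop :=
  [/\ K `<=` C, convex_set K &
      forall y, C y -> y <> 0 ->
        exists! p : R * V, [/\ 0 < p.1, K p.2 & y = p.1 *: p.2]].

End simplex.

Definition simplex (R : realType) (V : lmodType R) (K : set V) : Prop :=
  convex_set K /\
  exists (W : lmodType R) (C B : set W) (f : V -> W),
    [/\ lattice_cone C, cone_base C B, set_bij K B f & affine_on K f].

(* Measurable types have to be pointed, which a subset regarded as a type is
   not. The chosen point has no influence on the Borel sets. *)
Definition pointed_at (T : Type) (x : T) : Type := T.

HB.instance Definition _ (T : topologicalType) (x : T) :=
  Topological.copy (pointed_at x) T.
HB.instance Definition _ (T : topologicalType) (x : T) :=
  isPointed.Build (pointed_at x) x.

Notation borel x := (g_sigma_algebraType (@open (pointed_at x))).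

Definition regular_measure (R : realType) (T : topologicalType) (x0 : T)
    (mu : {measure set (borel x0) -> \bar R}) : Prop :=
  forall Y : set (borel x0), measurable Y ->
    mu Y = ereal_inf [set mu O | O in [set O : set T | open O /\ Y `<=` O]] /\
    mu Y = ereal_sup [set mu C | C in [set C : set T | closed C /\ C `<=` Y]].

(* A function on K is represented by a function on the whole space, of which
   only the restriction to K matters. *)
Section choquet.
Context {R : realType} {V : preTopologicalLmodType R} {K : set V} {x0 : K}.
Local Open Scope ereal_scope.

Definition msim (mu lambda : {measure set (borel x0) -> \bar R}) : Prop :=
  forall f : V -> R^o, {within K, continuous f} -> affine_on K f ->
    \int[mu]_x (f (\val (x : K)))%:E = \int[lambda]_x (f (\val (x : K)))%:E.

Definition mprec (mu lambda : {measure set (borel x0) -> \bar R}) : Prop :=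
  forall f : V -> R^o, {within K, continuous f} -> convex_function K f ->
    \int[mu]_x (f (\val (x : K)))%:E <= \int[lambda]_x (f (\val (x : K)))%:E.

(* Library measures are functions of all subsets, whose values are arbitrary
   outside the sigma-algebra: as Borel measures, they have to be compared on
   measurable sets only. *)
Definition meq (mu lambda : {measure set (borel x0) -> \bar R}) : Prop :=
  forall A, measurable A -> mu A = lambda A.

Definition maximal_measure (mu : {measure set (borel x0) -> \bar R}) : Prop :=
  forall lambda : {finite_measure set (borel x0) -> \bar R},
    regular_measure lambda -> mprec mu lambda -> meq lambda mu.

End choquet.

(* Main.v *)
(* The idea.  For a bounded function g on K = S(E), let g^ be its least concave
   majorant: g^(s) is the supremum of sum_i a_i g(x_i) over the finite convex
   combinations sum_i a_i x_i = s.  Any two such combinations of s have a common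
   refinement by the Riesz decomposition property of the cone over the simplex K;
   as refining increases sum_i a_i g(x_i) for convex g, the map g |-> g^(s) is
   additive on continuous convex functions.  It hence extends to a positive
   functional on the vector lattice of differences of continuous convex functions,
   which the Riesz representation theorem turns into a regular Borel probability
   measure mu.
   Conversely, if nu has barycentre s, cutting K into small pieces and replacing
   nu on each piece by a point mass at its barycentre (states are closed under
   averaging) gives nu(g) <= g^(s) = mu(g) for g continuous and convex.  Thus mu
   dominates every measure with barycentre s, which yields both the maximality of
   mu and the uniqueness of the maximal measure. *)

Require Import Defs.
From HB Require Import structures.
From mathcomp Require Import all_boot all_order all_algebra.
From mathcomp Require Import interval_inference lra ring.
From mathcomp Require Import all_classical all_reals all_analysis.

Set Implicit Arguments.
Unset Strict Implicit.
Unset Printing Implicit Defensive.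

Import Order.TTheory GRing.Theory Num.Theory.
Import numFieldNormedType.Exports.

Local Open Scope classical_set_scope.
Local Open Scope ring_scope.

(** * Riesz representation on a lattice of functions of a compact space *)

Lemma compact_finite_cover (T : topologicalType) (x0 : T) (A : set T) :
  compact A -> cover_compact A.
Proof.
by move=> cA; have : compact (A : set (pointed_at x0)) := cA; rewrite compact_cover.
Qed.

Section riesz.
Variables (R : realType) (T : topologicalType) (x0 : T) (L : set (T -> R)).

(** The part of C(T) on which the functional will live. The last clause asks for bumps at single
    points; [urysohn_lattice_sep] upgrades them to closed sets. *)
Definition urysohn_lattice : Prop :=
  [/\ L (cst 1),
      forall f, L f -> continuous f,
      forall a f g, L f -> L g -> L (fun x => a * f x + g x),
      forall f g, L f -> L g -> L (fun x => Num.max (f x) (g x)) &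
      forall (O : set T) x, open O -> O x ->
        exists f, [/\ L f, forall y, f y <= \1_O y & f x = 1]].

Definition positive_functional (I : (T -> R) -> R) : Prop :=
  [/\ I (cst 1) = 1,
      forall a f g, L f -> L g -> I (fun x => a * f x + g x) = a * I f + I g &
      forall f g, L f -> L g -> (forall x, f x <= g x) -> I f <= I g].

Hypothesis cT : compact [set: T].
Hypothesis UL : urysohn_lattice.

Let L1 : L (cst 1). Proof. by case: UL. Qed.
Let Lcont f : L f -> continuous f. Proof. by case: UL => _ + _ _ _; exact. Qed.
Let Llin a f g : L f -> L g -> L (fun x => a * f x + g x).
Proof. by case: UL => _ _ + _ _; exact. Qed.
Let Lmax f g : L f -> L g -> L (fun x => Num.max (f x) (g x)).
Proof. by case: UL => _ _ _ + _; exact. Qed.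

Lemma urysohn_lattice_cst a : L (cst a).
Proof.
have := Llin (a - 1) L1 L1; congr L; apply/funext => x /=.
by rewrite mulr1 subrK.
Qed.

Lemma urysohn_latticeZ a f : L f -> L (fun x => a * f x).
Proof.
move=> Lf; have := Llin a Lf (urysohn_lattice_cst 0).
by congr L; apply/funext => x /=; rewrite addr0.
Qed.

Lemma urysohn_latticeD f g : L f -> L g -> L (fun x => f x + g x).
Proof.
move=> Lf Lg; have := Llin 1 Lf Lg.
by congr L; apply/funext => x /=; rewrite mul1r.
Qed.

Lemma urysohn_latticeB f g : L f -> L g -> L (fun x => f x - g x).
Proof.
move=> Lf Lg; have := Llin (-1) Lg Lf.
by congr L; apply/funext => x /=; rewrite mulN1r addrC.
Qed.

Lemma urysohn_lattice_min f g :
  L f -> L g -> L (fun x => Num.min (f x) (g x)).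
Proof.
move=> Lf Lg; have := urysohn_latticeZ (-1) (Lmax (urysohn_latticeZ (-1) Lf)
  (urysohn_latticeZ (-1) Lg)).
by congr L; apply/funext => x /=; rewrite !mulN1r oppr_max !opprK.
Qed.

Lemma urysohn_lattice_closed f a : L f -> closed [set x | a <= f x].
Proof.
move=> Lf; rewrite (_ : mkset _ = f @^-1` [set y | a <= y]) //.
by apply: closed_comp => [x _|]; [exact: Lcont|exact: closed_ge].
Qed.

Lemma urysohn_lattice_open f a : L f -> open [set x | a < f x].
Proof.
move=> Lf; rewrite (_ : mkset _ = f @^-1` [set y | a < y]) //.
by apply: open_comp => [x _|]; [exact: Lcont|exact: open_gt].
Qed.

(** Urysohn's lemma inside [L]: finitely many bumps exceed 1/2 on open sets covering the compact set
    [C], and their maximum with 0 is doubled and cut off at 1. *)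
Lemma urysohn_lattice_sep (C O : set T) : closed C -> open O -> C `<=` O ->
  exists f, [/\ L f, forall x, \1_C x <= f x & forall x, f x <= \1_O x].
Proof.
move=> cC oO CO.
pose D := [set f | L f /\ forall x, f x <= \1_O x].
have ub (s : seq (T -> R)) : (forall f, f \in s -> D f) ->
  exists h, [/\ D h, forall x, 0 <= h x & forall f x, f \in s -> f x <= h x].
  elim: s => [_|f s IH Ds].
    exists (cst 0); split => //; split; first exact: urysohn_lattice_cst.
    by move=> x; rewrite indicE.
  have [|h [[Lh hO] h0 hs]] := IH.
    by move=> g gs; apply: Ds; rewrite inE gs orbT.
  have [Lf fO] : D f by apply: Ds; rewrite inE eqxx.
  exists (fun x => Num.max (f x) (h x)); split.
  - by split=> [|x]; [exact: Lmax|rewrite ge_max fO hO].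
  - by move=> x; rewrite le_max h0 orbT.
  - move=> g x; rewrite inE => /predU1P[->|/hs]; rewrite le_max ?lexx//.
    by move=> /(_ x) ->; rewrite orbT.
have := compact_finite_cover x0 (subclosed_compact cC cT (@subsetT _ C)).
case/(_ _ D (fun f => [set x | 1 / 2 < f x])) => [f [Lf _]|x Cx|s sD sC].
  exact: urysohn_lattice_open.
  have [_ _ _ _ /(_ O x oO (CO x Cx))[f [Lf fO fx]]] := UL.
  by exists f => //=; rewrite fx; lra.
have [|h [[Lh hO] h0 hs]] := ub (finmap.enum_fset s).
  by move=> f fs; have := sD f fs; rewrite inE.
exists (fun x => Num.min 1 (2 * h x)); split.
- exact: urysohn_lattice_min L1 (urysohn_latticeZ _ Lh).
- move=> x; rewrite indicE le_min; case: (asboolP (C x)) => [Cx|nCx].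
    rewrite mem_set//= lexx/=; have [f /= fs fx] := sC x Cx.
    have := hs f x fs; lra.
  by rewrite memNset//= ler01/= mulr_ge0.
- move=> x; have := hO x; rewrite indicE ge_min; have := h0 x.
  by case: (x \in O) => /= *; apply/orP; [left|right; lra].
Qed.

Variable I : (T -> R) -> R.
Hypothesis PI : positive_functional I.

Let I1 : I (cst 1) = 1. Proof. by case: PI. Qed.
Let Ilin a f g : L f -> L g -> I (fun x => a * f x + g x) = a * I f + I g.
Proof. by case: PI => _ + _; exact. Qed.
Let Ile f g : L f -> L g -> (forall x, f x <= g x) -> I f <= I g.
Proof. by case: PI => _ _; exact. Qed.

Lemma positive_functional_cst a : I (cst a) = a.
Proof.
have -> : cst a = (fun x => (a - 1) * cst 1 x + cst 1 x) :> (T -> R).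
  by apply/funext => x /=; rewrite mulr1 subrK.
by rewrite Ilin// I1 mulr1 subrK.
Qed.

Lemma positive_functionalZ a f : L f -> I (fun x => a * f x) = a * I f.
Proof.
move=> Lf; rewrite -[RHS]addr0 -[X in _ + X](positive_functional_cst 0) -Ilin//.
  by congr I; apply/funext => x /=; rewrite addr0.
exact: urysohn_lattice_cst.
Qed.

Lemma positive_functionalD f g :
  L f -> L g -> I (fun x => f x + g x) = I f + I g.
Proof.
move=> Lf Lg; rewrite -[X in X + _]mul1r -Ilin//; congr I.
by apply/funext => x /=; rewrite mul1r.
Qed.

Lemma positive_functionalB f g :
  L f -> L g -> I (fun x => f x - g x) = I f - I g.
Proof.
move=> Lf Lg; rewrite addrC -mulN1r -Ilin//; congr I.
by apply/funext => x /=; rewrite mulN1r addrC.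
Qed.

Local Open Scope ereal_scope.

(* No condition on supports is needed: by compactness, [f <= \1_O] forces
   [{f >= e}] to be a compact subset of [O] for every [e > 0]. *)
Definition riesz_content (O : set T) : \bar R :=
  ereal_sup [set (I f)%:E | f in [set f | L f /\ forall x, (f x <= \1_O x)%R]].

Definition riesz_outer (A : set T) : \bar R :=
  ereal_inf [set riesz_content O | O in [set O | open O /\ A `<=` O]].

Lemma riesz_content_ub O f : L f -> (forall x, (f x <= \1_O x)%R) ->
  (I f)%:E <= riesz_content O.
Proof. by move=> Lf fO; apply: ereal_sup_ubound; exists f. Qed.

Lemma le_riesz_content O1 O2 : O1 `<=` O2 -> riesz_content O1 <= riesz_content O2.
Proof.
move=> O12; apply: ge_ereal_sup => _ [f [Lf fO] <-].
apply: riesz_content_ub => // x; rewrite (le_trans (fO x))//.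
rewrite !indicE; have [/set_mem/O12 ?|_] := boolP (x \in O1) => //.
by rewrite mem_set.
Qed.

Lemma riesz_content_ge0 O : 0 <= riesz_content O.
Proof.
rewrite -[leLHS]/(0%R%:E) -(positive_functional_cst 0).
apply: riesz_content_ub.
  exact: urysohn_lattice_cst.
by move=> x; rewrite indicE.
Qed.

Lemma riesz_content_le1 O : riesz_content O <= 1.
Proof.
apply: ge_ereal_sup => _ [f [Lf fO] <-].
rewrite -[leRHS]/(1%R%:E) lee_fin -I1.
apply: Ile => // x; rewrite (le_trans (fO x))// indicE.
by case: (_ \in _).
Qed.

Lemma riesz_contentT : riesz_content setT = 1.
Proof.
apply/eqP; rewrite eq_le riesz_content_le1/= -[leLHS]/(1%R%:E) -I1.
by rewrite riesz_content_ub// => x; rewrite indicT.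
Qed.

Lemma riesz_content_fin O : riesz_content O \is a fin_num.
Proof.
rewrite ge0_fin_numE ?riesz_content_ge0//.
by rewrite (le_lt_trans (riesz_content_le1 O))// ltry.
Qed.

Lemma riesz_content0 : riesz_content set0 = 0.
Proof.
apply/eqP; rewrite eq_le riesz_content_ge0 andbT.
apply: ge_ereal_sup => _ [f [Lf fO] <-].
rewrite -[leRHS]/(0%R%:E) lee_fin -(positive_functional_cst 0); apply: Ile => //.
  exact: urysohn_lattice_cst.
by move=> x; rewrite (le_trans (fO x))// indic0.
Qed.

(** The part of [{f >= e}] outside [O2] is a closed subset of [O1], so some [h] below the indicator
    of [O1] is at least 1 there. Then [f - h - e] lies below the indicator of [O2], and [f] is the
    sum of [h], [f - h - e] and [e]. *)
Lemma riesz_contentU O1 O2 : open O1 -> open O2 ->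
  riesz_content (O1 `|` O2) <= riesz_content O1 + riesz_content O2.
Proof.
move=> oO1 oO2; apply: ge_ereal_sup => _ [f [Lf fO] <-].
apply/lee_addgt0Pr => e e0.
have cC : closed ([set x | (e <= f x)%R] `&` ~` O2).
  by apply: closedI; [exact: urysohn_lattice_closed|exact: open_closedC].
have [|h [Lh h1 h2]] := urysohn_lattice_sep cC oO1.
  move=> x /= [efx nO2]; have := fO x; rewrite indicE.
  have [/set_mem[//|//]|_ f0] := boolP (x \in _).
  by have := lt_le_trans e0 (le_trans efx f0); rewrite ltxx.
have Lk : L (fun x => f x - h x)%R by exact: urysohn_latticeB.
have Lk' := urysohn_latticeB Lk (urysohn_lattice_cst e).
have -> : I f = (I h + I (fun x => f x - h x - cst e x)%R + e)%R.
  rewrite (positive_functionalB Lk (urysohn_lattice_cst e)).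
  by rewrite (positive_functionalB Lf Lh) positive_functional_cst; lra.
rewrite !EFinD leeD2r// leeD//; first exact: riesz_content_ub.
apply: riesz_content_ub => // x /=; have := h1 x; have := h2 x.
have := fO x.
rewrite !indicE in_setU in_setI in_setC.
case: (boolP (x \in O2)) => [xO2|xO2] /=.
  by rewrite orbT andbF; case: (x \in O1) => /=; lra.
rewrite orbF andbT; have [/set_mem/=|/negP] := boolP (x \in mkset _).
  by case: (x \in O1) => /=; lra.
by rewrite inE => /negP; rewrite -ltNge => /=; case: (x \in O1) => /=; lra.
Qed.

(** Compactness reduces the union to a finite one: finitely many [F n] cover [{f >= e}], and [f - e]
    is nonpositive elsewhere. *)
Lemma riesz_content_bigcup (F : (set T)^nat) : (forall n, open (F n)) ->
  riesz_content (\bigcup_n F n) <= \sum_(n <oo) riesz_content (F n).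
Proof.
move=> oF; apply: ge_ereal_sup => _ [f [Lf fO] <-].
apply/lee_addgt0Pr => e e0.
have := compact_finite_cover x0
  (subclosed_compact (urysohn_lattice_closed (a := e) Lf) cT (@subsetT _ _)).
case/(_ _ setT F) => [//|x /= efx|s _ sF].
  have := fO x; rewrite indicE.
  have [/set_mem//|_ f0] := boolP (x \in _).
  by have := lt_le_trans e0 (le_trans efx f0); rewrite ltxx.
(* [n] exceeds every index of the finite subcover, which thus lies among the first [n] sets. *)
pose n := (\max_(i <- finmap.enum_fset s) i).+1%N.
have fs : forall x, (e <= f x)%R -> (\big[setU/set0]_(i < n) F i) x.
  move=> x /sF[i /= si Fix]; rewrite -bigcup_mkord; exists i => //=.
  by rewrite /n ltnS; apply: (@leq_bigmax_seq _ _ xpredT id).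
have -> : I f = (I (fun x => f x - cst e x)%R + e)%R.
  by rewrite (positive_functionalB Lf (urysohn_lattice_cst e))
    positive_functional_cst subrK.
rewrite EFinD leeD2r//.
apply: (@le_trans _ _ (riesz_content (\big[setU/set0]_(i < n) F i))).
  apply: riesz_content_ub.
    exact: urysohn_latticeB (urysohn_lattice_cst e).
  move=> x; rewrite indicE; have := fO x; rewrite indicE => fx.
  have [xO|xO] := boolP (x \in \big[setU/set0]_(i < n) F i).
    by move: fx; case: (x \in _) => /=; lra.
  rewrite /= subr_le0 leNgt; apply/negP => /ltW/fs xO'.
  by move/negP: xO; apply; rewrite inE.
apply: (@le_trans _ _ (\sum_(i < n) riesz_content (F i))).
  elim: n {fs} => [|n IH]; first by rewrite !big_ord0 riesz_content0.
  have oU : open (\big[setU/set0]_(i < n) F i).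
    by apply: (big_ind open) => // *; [exact: open0|exact: openU].
  rewrite !big_ord_recr/=.
  by rewrite (le_trans (riesz_contentU oU (oF n)))// leeD2r.
rewrite -(big_mkord xpredT (riesz_content \o F)).
apply: (nneseries_lim_ge n) => ? _ _; exact: riesz_content_ge0.
Qed.

Lemma riesz_outer_open O : open O -> riesz_outer O = riesz_content O.
Proof.
move=> oO; apply/eqP; rewrite eq_le; apply/andP; split.
  by apply: ereal_inf_lbound; exists O; [split|].
by apply: le_ereal_inf_tmp => _ [U [oU OU] <-]; exact: le_riesz_content.
Qed.

Lemma le_riesz_outer A B : A `<=` B -> riesz_outer A <= riesz_outer B.
Proof.
move=> AB; apply: ereal_inf_le_tmp => _ [U [oU BU] <-].
by exists U => //; split => //; exact: subset_trans BU.
Qed.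

Lemma riesz_outer_ge0 A : 0 <= riesz_outer A.
Proof.
by apply: le_ereal_inf_tmp => _ [U [oU OU] <-]; exact: riesz_content_ge0.
Qed.

Lemma riesz_outer0 : riesz_outer set0 = 0.
Proof. by rewrite riesz_outer_open ?riesz_content0//; exact: open0. Qed.

Lemma riesz_outer_fin A : riesz_outer A \is a fin_num.
Proof.
rewrite ge0_fin_numE ?riesz_outer_ge0//.
rewrite (le_lt_trans (le_riesz_outer (@subsetT _ A)))//.
by rewrite riesz_outer_open ?riesz_contentT ?ltry//; exact: openT.
Qed.

Lemma riesz_outer_approx A (e : R) : (0 < e)%R ->
  exists O, [/\ open O, A `<=` O & riesz_content O <= riesz_outer A + e%:E].
Proof.
move=> e0; have : riesz_outer A < riesz_outer A + e%:E.
  by rewrite lteDl ?lte_fin// riesz_outer_fin.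
move=> /ereal_inf_lt[_ [U [oU AU] <-] /ltW UA].
by exists U.
Qed.

Lemma riesz_outer_sigma_subadditive : sigma_subadditive riesz_outer.
Proof.
move=> F; apply/lee_addgt0Pr => e e0.
have /choice[G GP] : forall n, exists O, [/\ open O, F n `<=` O &
    riesz_content O <= riesz_outer (F n) + (e / (2 ^ n.+1)%:R)%:E].
  by move=> n; apply: riesz_outer_approx; rewrite divr_gt0 ?ltr0n ?expn_gt0.
apply: (@le_trans _ _ (riesz_content (\bigcup_n G n))).
  apply: ereal_inf_lbound; exists (\bigcup_n G n) => //; split.
    by apply: bigcup_open => n _; case: (GP n).
  by apply: subset_bigcup => n _; case: (GP n).
rewrite (le_trans (riesz_content_bigcup _))//; first by move=> n; case: (GP n).
apply: (@le_trans _ _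
    (\sum_(n <oo) (riesz_outer (F n) + (e / (2 ^ n.+1)%:R)%:E))).
  apply: lee_nneseries => n _; first by move=> *; exact: riesz_content_ge0.
  by case: (GP n).
by apply: epsilon_trick => [n|]; [exact: riesz_outer_ge0|exact: ltW].
Qed.

(** [X] may be replaced by an open superset [U]. For [f] below the indicator of [U] and [O],
    removing [{f >= e}] from [U] leaves an open [G] that still contains [U] minus [O]. If [g] lies
    below the indicator of [G], then [f + g - e] lies below that of [U], since [g <= 0] wherever
    [f >= e]. *)
Lemma riesz_outer_caratheodory O : open O -> riesz_outer.-caratheodory O.
Proof.
move=> oO.
pose om_axioms := isOuterMeasure.Build R T riesz_outer riesz_outer0
  riesz_outer_ge0 le_riesz_outer riesz_outer_sigma_subadditive.
pose om : {outer_measure set T -> \bar R} := HB.pack riesz_outer om_axioms.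
apply: (@le_caratheodory_measurable _ _ om) => X; rewrite /om/=.
apply: le_ereal_inf_tmp => _ [U [oU XU] <-].
apply: (@le_trans _ _ (riesz_outer (U `&` O) + riesz_outer (U `&` ~` O))).
  by rewrite leeD// le_riesz_outer//; apply: setSI.
rewrite riesz_outer_open; last exact: openI.
rewrite -leeBrDr ?riesz_outer_fin//.
apply: ge_ereal_sup => _ [f [Lf fUO] <-].
rewrite leeBrDr ?riesz_outer_fin//.
apply/lee_addgt0Pr => e e0.
pose G := U `&` ~` [set x | (e <= f x)%R].
have oG : open G by apply: openI => //; apply/closed_openC/urysohn_lattice_closed.
have UG : U `&` ~` O `<=` G.
  move=> x [Ux nOx]; split => //= efx; have := fUO x; rewrite indicE.
  have [/set_mem[//]|_ f0] := boolP (x \in _).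
  by have := lt_le_trans e0 (le_trans efx f0); rewrite ltxx.
apply: (@le_trans _ _ ((I f)%:E + riesz_content G)).
  by rewrite leeD2l// -(riesz_outer_open oG) le_riesz_outer.
rewrite -leeBrDl// ; apply: ge_ereal_sup => _ [g [Lg gG] <-].
rewrite leeBrDl//.
have Lk := urysohn_latticeB (urysohn_latticeD Lf Lg) (urysohn_lattice_cst e).
have -> : (I f)%:E + (I g)%:E = (I (fun x => f x + g x - cst e x)%R)%:E + e%:E.
  rewrite -!EFinD (positive_functionalB (urysohn_latticeD Lf Lg)
    (urysohn_lattice_cst e)) positive_functionalD// positive_functional_cst.
  by rewrite subrK.
rewrite leeD2r//; apply: riesz_content_ub => // x; rewrite /cst.
have := gG x; have := fUO x; rewrite !indicE !in_setI !in_setC.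
have [/set_mem/=|/negP] := boolP (x \in mkset _).
  by move=> ? /=; case: (x \in U); case: (x \in O) => /=; lra.
by rewrite inE => /negP; rewrite -ltNge => /=;
  case: (x \in U); case: (x \in O) => /=; lra.
Qed.

End riesz.

(** * Borel measurability and integrability of continuous functions *)

Section borel.
Variables (R : realType) (T : topologicalType) (x0 : T).

Lemma continuous_borel_measurable (f : T -> R) :
  continuous f -> measurable_fun setT (f : borel x0 -> R).
Proof.
move=> cf; apply: (measurability _ (measurable_realfun.RGenOpens.measurableE R)).
move=> _ [_ [a [b ->]] <-]; rewrite setTI; apply: sub_sigma_algebra.
by apply: open_comp => [x _|]; [exact: cf|exact: interval_open].
Qed.

Lemma open_borel_measurable (O : set T) :
  open O -> measurable (O : set (borel x0)).
Proof. by move=> oO; exact: sub_sigma_algebra. Qed.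

Lemma closed_borel_measurable (C : set T) :
  closed C -> measurable (C : set (borel x0)).
Proof.
by move=> cC; rewrite -[C]setCK; apply: measurableC;
  apply: open_borel_measurable; exact: closed_openC.
Qed.

Hypothesis cT : compact [set: T].

Lemma continuous_bounded (f : T -> R) :
  continuous f -> exists M, forall x, `|f x| <= M.
Proof.
move=> cf; have : compact (f @` [set: T]).
  by apply: continuous_compact => //; exact: continuous_subspaceT.
move=> /compact_bounded[M [_ /(_ (M + 1))]]; rewrite ltrDl => /(_ ltr01) fM.
by exists (M + 1) => x; apply: fM; exists x.
Qed.

Lemma continuous_integrable (mu : {finite_measure set (borel x0) -> \bar R})
    (A : set (borel x0)) (f : T -> R) : measurable A ->
  continuous f -> mu.-integrable A (EFin \o f).
Proof.
move=> mA cf; apply: measurable_bounded_integrable => //.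
- rewrite (le_lt_trans (le_measure mu _ _ (@subsetT _ A))) ?inE//.
  by rewrite fin_num_fun_lty//; exact: fin_num_measure.
- by apply: measurable_funTS; exact: continuous_borel_measurable.
- have [M fM] := continuous_bounded cf; exists M.
  split=> [|y My x _ /=]; first exact: num_real.
  by rewrite (le_trans (fM x))// ltW.
Qed.

End borel.

(** * The regular Borel measure extending the content *)

Section riesz_measure.
Variables (R : realType) (T : topologicalType) (x0 : T) (L : set (T -> R)).
Variable I : (T -> R) -> R.
Hypothesis cT : compact [set: T].
Hypothesis UL : urysohn_lattice L.
Hypothesis PI : positive_functional L I.
Local Open Scope ereal_scope.

Local Notation m := (riesz_content L I).

Lemma riesz_measure_exists : exists mu : probability (borel x0) R,
  regular_measure mu /\ forall O, open O -> mu O = m O.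
Proof.
pose om_axioms := isOuterMeasure.Build R T (riesz_outer L I)
  (riesz_outer0 UL PI) (riesz_outer_ge0 UL PI) (@le_riesz_outer _ _ L I)
  (riesz_outer_sigma_subadditive x0 cT UL PI).
pose om : {outer_measure set (pointed_at x0) -> \bar R} :=
  HB.pack (riesz_outer L I) om_axioms.
(* The Caratheodory sets form a sigma-algebra containing the open sets, hence all Borel sets. *)
have mcara (A : set (borel x0)) : measurable A -> om.-caratheodory A.
  move=> mA; have : measurable (A : set (caratheodory_type om)); last by [].
  apply: mA; split; first exact: sigma_algebra_measurable.
  exact: (riesz_outer_caratheodory x0 cT UL PI).
have sadd : semi_sigma_additive (riesz_outer L I : set (borel x0) -> \bar R).
  move=> F mF tF mUF.
  exact: (@caratheodory_measure_sigma_additive _ _ om F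
    (fun i => mcara _ (mF i)) tF (mcara _ mUF)).
pose mu_axioms := isMeasure.Build _ (borel x0) R
  (riesz_outer L I : set (borel x0) -> \bar R)
  (riesz_outer0 UL PI) (riesz_outer_ge0 UL PI) sadd.
pose mu0 : {measure set (borel x0) -> \bar R} :=
  HB.pack (riesz_outer L I : set (borel x0) -> \bar R) mu_axioms.
have mu0T : mu0 setT = 1.
  by rewrite /mu0/= riesz_outer_open; [exact: riesz_contentT|exact: openT].
pose P_axioms := Measure_isProbability.Build _ (borel x0) R mu0 mu0T.
pose mu : probability (borel x0) R :=
  HB.pack (riesz_outer L I : set (borel x0) -> \bar R) mu_axioms P_axioms.
have muE A : mu A = riesz_outer L I A by [].
have muO O : open O -> mu O = m O by move=> oO; rewrite muE riesz_outer_open.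
have outer Y :
    mu Y = ereal_inf [set mu O | O in [set O : set T | open O /\ Y `<=` O]].
  rewrite muE /riesz_outer; congr ereal_inf; apply/seteqP.
  by split=> _ [U [oU YU] <-]; exists U => //; rewrite muO.
exists mu; split => // Y mY; split; first exact: outer.
apply/eqP; rewrite eq_le; apply/andP; split; last first.
  apply: ge_ereal_sup => _ [C [cC CY] <-].
  by apply: le_measure; rewrite ?inE//; exact: closed_borel_measurable.
apply/lee_addgt0Pr => e e0.
(* Inner regularity by complementation: an open [U] tightly enclosing the complement of [Y] leaves a
   closed subset of [Y], and the total mass is 1. *)
have [U [oU YU]] := riesz_outer_approx UL PI (~` Y) e0.
rewrite -riesz_outer_open// -!muE => Ue.
have mU : measurable (U : set (borel x0)) by exact: open_borel_measurable.
have : mu (~` U) <=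
    ereal_sup [set mu C | C in [set C : set T | closed C /\ C `<=` Y]].
  apply: ereal_sup_ubound; exists (~` U) => //; split; first exact: open_closedC.
  by rewrite -[Y]setCK; exact: subsetC.
move: Ue; rewrite (probability_setC mu mU) (probability_setC mu mY).
rewrite -[X in _ -> _ -> X <= _]/(mu Y).
rewrite -(fineK (fin_num_measure mu _ mU)) -(fineK (fin_num_measure mu _ mY)).
move: (fine (mu U)) (fine (mu Y)) => u y.
rewrite -[1]/(1%R%:E) -EFinB -EFinD lee_fin.
case: (ereal_sup _) => [z| |].
- by rewrite -EFinD !lee_fin; lra.
- by move=> *; rewrite leey.
- by rewrite leeNy_eq.
Qed.

End riesz_measure.

(** * Uniqueness of the regular measure, and integrals as values of the functional *)

Section integral.
Variables (R : realType) (T : topologicalType) (x0 : T) (L : set (T -> R)).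
Hypothesis cT : compact [set: T].
Hypothesis UL : urysohn_lattice L.

Let Lcont f : L f -> continuous f. Proof. by case: UL => _ + _ _ _; exact. Qed.

(** By inner regularity it suffices to bound [nu C] for closed [C] inside [O]; a separating [f] in
    [L] gives [nu C <= nu(f) = mu(f) <= mu O]. *)
Lemma regular_le_open (mu nu : {finite_measure set (borel x0) -> \bar R})
    (O : set T) :
  regular_measure nu ->
  (forall f, L f -> \int[nu]_x (f x)%:E = \int[mu]_x (f x)%:E)%E ->
  open O -> (nu O <= mu O)%E.
Proof.
move=> rnu munu oO; have mO := open_borel_measurable (x0 := x0) oO.
rewrite (rnu O mO).2; apply: ge_ereal_sup => _ [C [cC CO] <-].
have mC := closed_borel_measurable (x0 := x0) cC.
have iL mu' f : L f -> (mu' : {finite_measure set (borel x0) -> \bar R}).-integrable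
    setT (EFin \o f).
  by move=> Lf; apply: (continuous_integrable cT) => //; exact: Lcont.
have [f [Lf Cf fO]] := urysohn_lattice_sep x0 cT UL cC oO CO.
apply: (@le_trans _ _ (\int[nu]_x (f x)%:E)%E).
  rewrite [leLHS](_ : _ = \int[nu]_x (\1_(C : set (borel x0)) x)%:E)%E; last first.
    by rewrite integral_indic// setIT.
  apply: le_integral => //; [exact: integrable_indic|exact: iL|].
  by move=> x _; rewrite lee_fin.
rewrite [leRHS](_ : _ = \int[mu]_x (\1_(O : set (borel x0)) x)%:E)%E; last first.
  by rewrite integral_indic// setIT.
rewrite munu//.
apply: le_integral => //; [exact: iL|exact: integrable_indic|].
by move=> x _; rewrite lee_fin.
Qed.

(** Outer regularity reduces the claim to open sets, where [regular_le_open] applies in both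
    directions. *)
Lemma regular_measure_eq (mu nu : {finite_measure set (borel x0) -> \bar R}) :
  regular_measure mu -> regular_measure nu ->
  (forall f, L f -> \int[nu]_x (f x)%:E = \int[mu]_x (f x)%:E)%E ->
  forall A, measurable A -> nu A = mu A.
Proof.
move=> rmu rnu munu A mA; rewrite (rmu A mA).1 (rnu A mA).1.
congr ereal_inf; apply/seteqP; split=> _ [U [oU AU] <-]; exists U => //;
  apply/eqP; rewrite eq_le !regular_le_open// => f Lf; rewrite munu//.
Qed.

Variable I : (T -> R) -> R.
Hypothesis PI : positive_functional L I.

Section representation.
Variable mu : probability (borel x0) R.
Hypothesis muO : forall O : set T, open O -> mu O = riesz_content L I O.

Local Notation J f := (\int[mu]_x (f x)).

Let intL f : L f -> mu.-integrable setT (EFin \o f).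
Proof. by move=> Lf; apply: (continuous_integrable cT) => //; exact: Lcont. Qed.

Let level (f : T -> R) (c : R) (k : nat) : R :=
  fine (riesz_content L I [set x | k%:R * c < f x]).

Let trunc (f : T -> R) (c : R) (k : nat) : T -> R :=
  fun x => Num.min (f x) (k%:R * c).

(* Slicing [f] at the heights [k c]: each slice [trunc k.+1 - trunc k] lies between
   [c] times the indicators of [f > (k+1) c] and of [f > k c], and telescoping
   leaves an error of at most [c]. *)
Let truncation_le (f : T -> R) (c : R) n : L f -> (forall x, 0 <= f x) ->
  0 < c -> I (trunc f c n) + c * level f c n <= J (trunc f c n) + c * level f c 0.
Proof.
move=> Lf f0 c0; set a := level f c; set g := trunc f c.
have Lg k : L (g k).
  exact: (urysohn_lattice_min UL Lf (urysohn_lattice_cst UL (k%:R * c))).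
have gS k x : g k x <= g k.+1 x.
  rewrite /g /trunc -natr1 mulrDl mul1r; set d := k%:R * c.
  by rewrite le_min ge_min lexx/= ge_min; apply/orP; right; lra.
elim: n => [|n IH].
  have -> : g 0 = cst 0.
    by apply/funext => x; rewrite /g /trunc mul0r; apply/min_idPr.
  by rewrite (positive_functional_cst UL PI) Rintegral_cst//= mul0r.
have Iup : I (g n.+1) <= I (g n) + c * a n.
  pose h x := c^-1 * (g n.+1 x - g n x).
  have Lh : L h by apply: (urysohn_latticeZ UL); exact: (urysohn_latticeB UL).
  have hI : I h = c^-1 * (I (g n.+1) - I (g n)).
    by rewrite (positive_functionalZ UL PI) ?(positive_functionalB PI)//;
      exact: (urysohn_latticeB UL).
  have : ((I h)%:E <= riesz_content L I [set x | n%:R * c < f x]%R)%E.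
    apply: riesz_content_ub => // x; rewrite indicE /h ler_pdivrMl//.
    rewrite /g /trunc -natr1 mulrDl mul1r; set d := n%:R * c.
    have [/set_mem/=|/negP] := boolP (x \in mkset _).
      by rewrite mulr1; case: (leP (f x) (d + c)); case: (leP (f x) d); lra.
    rewrite inE => /negP/=; rewrite -leNgt => fd.
    have fdc : f x <= d + c by rewrite (le_trans fd)// lerDl ltW.
    by rewrite mulr0 (min_idPl fd) (min_idPl fdc) subrr.
  rewrite -(fineK (riesz_content_fin UL PI _)) lee_fin hI ler_pdivrMl//.
  by rewrite lerBlDl.
have Jup : J (g n) + c * a n.+1 <= J (g n.+1).
  have mU : measurable ([set x | n.+1%:R * c < f x] : set (borel x0)).
    by apply: open_borel_measurable; exact: (urysohn_lattice_open UL _ Lf).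
  pose U : set (borel x0) := [set x | n.+1%:R * c < f x].
  have -> : c * a n.+1 = J (fun x => c * \1_U x).
    rewrite RintegralZl//; last exact: integrable_indic.
    rewrite /Rintegral integral_indic// setIT.
    congr (_ * fine _); symmetry; apply: muO.
    exact: (urysohn_lattice_open UL _ Lf).
  have iU : mu.-integrable setT (EFin \o (fun x => c * \1_U x)).
    rewrite (_ : _ \o _ = fun x => c%:E * (\1_U x)%:E)%E//.
    by apply: integrableZl => //; exact: integrable_indic.
  rewrite -RintegralD//; last exact: intL.
  apply: le_Rintegral => //; [|exact: intL|].
    by apply: (integrableD _ (intL (Lg n)) iU).
  move=> x _; rewrite indicE /g /trunc.
  have [/set_mem/=|_] := boolP (x \in U); last by rewrite mulr0 addr0; exact: gS.
  rewrite /U/= -[n.+1%:R]natr1 mulrDl mul1r mulr1; set d := n%:R * c => df.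
  by case: (leP (f x) (d + c)); case: (leP (f x) d); lra.
lra.
Qed.

(** For a nonnegative function, once [n c] exceeds a bound the last truncation is the function
    itself, and the error in [truncation_le] is at most [c] because the content is at most 1. Adding
    a constant gives the general case. *)
Let riesz_integral_ge (f : T -> R) : L f -> I f <= J f.
Proof.
have key g : L g -> (forall x, 0 <= g x) -> I g <= J g.
  move=> Lg g0; apply/ler_addgt0Pr => c c0.
  have [M gM] := continuous_bounded cT (Lcont Lg).
  pose n := Num.bound `|M / c|.
  have := truncation_le n Lg g0 c0; rewrite /trunc /level.
  have -> : (fun x => Num.min (g x) (n%:R * c)) = g.
    apply/funext => x; apply/min_idPl.
    rewrite (le_trans (ler_norm _))// (le_trans (gM x))// -ler_pdivrMr//.
    by rewrite (le_trans (ler_norm _))// ltW// /n archi_boundP.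
  have := riesz_content_le1 UL PI [set x | 0%:R * c < g x].
  have := riesz_content_ge0 UL PI [set x | n%:R * c < g x].
  rewrite -(fineK (riesz_content_fin UL PI _)) lee_fin => an.
  rewrite -(fineK (riesz_content_fin UL PI _)) lee_fin => a0.
  have : c * fine (riesz_content L I [set x | (0%:R * c < g x)]) <= c * 1.
    by rewrite ler_pM2l.
  have := mulr_ge0 (ltW c0) an; lra.
move=> Lf; have [M fM] := continuous_bounded cT (Lcont Lf).
have LM := urysohn_lattice_cst UL M.
have := key _ (urysohn_latticeD UL Lf LM).
rewrite (positive_functionalD PI)// (positive_functional_cst UL PI).
have -> : J (fun x => f x + cst M x) = J f + M.
  rewrite RintegralD//; [|exact: intL|exact: intL].
  by rewrite Rintegral_cst//= probability_setT mulr1.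
rewrite lerD2r; apply => x; rewrite /cst.
by have := fM x; rewrite ler_norml; lra.
Qed.

(** The inequality of [riesz_integral_ge] for [-1 * f] is the converse inequality for [f]. *)
Lemma riesz_integral (f : T -> R) :
  L f -> (\int[mu]_x (f x)%:E)%E = (I f)%:E.
Proof.
move=> Lf; rewrite -[LHS]fineK; last first.
  by apply: integrable_fin_num => //; exact: intL.
congr EFin; apply/eqP; rewrite eq_le riesz_integral_ge// andbT.
have := riesz_integral_ge (urysohn_latticeZ UL (-1) Lf).
rewrite (positive_functionalZ UL PI)// RintegralZl//; last exact: intL.
by rewrite !mulN1r lerN2.
Qed.

End representation.

Lemma riesz_representation : exists mu : probability (borel x0) R,
  regular_measure mu /\
  forall f, L f -> (\int[mu]_x (f x)%:E = (I f)%:E)%E.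
Proof.
have [mu [rmu muO]] := riesz_measure_exists x0 cT UL PI.
by exists mu; split => // f Lf; exact: riesz_integral.
Qed.

End integral.

(** * Common refinements in a lattice cone, and concave envelopes *)

Section cone.
Variables (R : realType) (W : lmodType R) (C : set W).
Hypothesis latC : lattice_cone C.

Let C0 : C 0. Proof. by case: latC => -[[]]. Qed.

Let CD x y : C x -> C y -> C (x + y).
Proof.
case: latC => -[[_ + _] _] Cx Cy => /(_ 1 1 x y ler01 ler01 Cx Cy).
by rewrite !scale1r.
Qed.

Let Csum (l : seq W) : (forall u, u \in l -> C u) -> C (\sum_(u <- l) u).
Proof.
elim: l => [|u l IH] Cl; first by rewrite big_nil.
rewrite big_cons; apply: CD; first by apply: Cl; rewrite mem_head.
by apply: IH => v vl; apply: Cl; rewrite inE vl orbT.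
Qed.

Let Cpointed x : C x -> C (- x) -> x = 0.
Proof.
case: latC => -[_ CN] _ Cx CNx; suff : [set 0 : W] x by [].
by rewrite -CN; split => //; exists (- x) => //; rewrite opprK.
Qed.

Let Csum_eq0 (l : seq W) : (forall u, u \in l -> C u) -> \sum_(u <- l) u = 0 ->
  forall u, u \in l -> u = 0.
Proof.
elim: l => [//|u l IH] Cl; rewrite big_cons => ul0.
have Cu : C u by apply: Cl; rewrite mem_head.
have Cl' v : v \in l -> C v by move=> vl; apply: Cl; rewrite inE vl orbT.
have u0 : u = 0.
  apply: Cpointed => //; move/eqP: ul0; rewrite addrC addr_eq0 => /eqP <-.
  exact: Csum.
move=> v; rewrite inE => /predU1P[->//|]; apply: IH => //.
by move: ul0; rewrite u0 add0r.
Qed.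

(* [x \/ z] exists by hypothesis, and [z + x - (z \/ x)] is the meet of [z] and
   [x], i.e., the largest part of [z] that [x] can absorb. *)
Let riesz_split x y z : C x -> C y -> C z -> C (x + y - z) ->
  exists z1 z2, [/\ C z1, C z2, z = z1 + z2, C (x - z1) & C (y - z2)].
Proof.
move=> Cx Cy Cz Cxyz.
have [[j [Cj zj xj jmin]] _] := (latC.2 z x Cz Cx).
exists (z + x - j), (j - x); split.
- apply: jmin; rewrite /cone_le; first exact: CD.
    by rewrite addrAC subrr add0r.
  by rewrite addrK.
- exact: xj.
- by rewrite addrA subrK addrK.
- suff -> : x - (z + x - j) = j - z by exact: zj.
  by rewrite opprB addrCA opprD [x + _]addrCA subrr addr0.
- rewrite opprB addrA (addrC y); apply: jmin; rewrite /cone_le//; first exact: CD.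
  by rewrite addrAC subrr add0r.
Qed.

(** Each entry of [us] is cut into its share of [v] and its share of [r]. By induction,
    [riesz_split] lets the head absorb a part [v1] of [v], and the rest [v2] lies below the sum of
    the tail. *)
Lemma riesz_split_seq (us : seq W) v r : (forall u, u \in us -> C u) ->
  C v -> C r -> \sum_(u <- us) u = v + r ->
  exists l : seq (W * W),
    [/\ forall p, p \in l -> C p.1 /\ C p.2,
        us = [seq p.1 + p.2 | p <- l],
        \sum_(p <- l) p.1 = v & \sum_(p <- l) p.2 = r].
Proof.
elim: us v r => [|u us IH] v r Cus Cv Cr.
  rewrite big_nil => /esym/eqP; rewrite addr_eq0 => /eqP vr.
  have r0 : r = 0 by apply: Cpointed => //; rewrite -vr.
  by exists [::]; rewrite !big_nil vr r0 oppr0.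
rewrite big_cons => uv.
have Cu : C u by apply: Cus; rewrite mem_head.
have Cus' w : w \in us -> C w by move=> wu; apply: Cus; rewrite inE wu orbT.
have [] := @riesz_split u (\sum_(w <- us) w) v => //; first exact: Csum.
  by rewrite uv addrAC subrr add0r.
move=> v1 [v2 [Cv1 Cv2 vE Cuv1 Cuv2]].
have [|l [Cl usE l1 l2]] := IH v2 (\sum_(w <- us) w - v2) Cus' Cv2 Cuv2.
  by rewrite addrC subrK.
exists ((v1, u - v1) :: l); split.
- by move=> p; rewrite inE => /predU1P[->//|/Cl].
- by rewrite /= addrC subrK usE.
- by rewrite big_cons l1.
- rewrite big_cons l2 /= addrACA -opprD -vE uv.
  by rewrite addrAC subrr add0r.
Qed.

Definition sublinear_on (F : W -> R) : Prop :=
  F 0 = 0 /\ forall x y, C x -> C y -> F (x + y) <= F x + F y.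

Let sublinear_sum F (l : seq W) : sublinear_on F -> (forall u, u \in l -> C u) ->
  F (\sum_(u <- l) u) <= \sum_(u <- l) F u.
Proof.
move=> [F0 FD]; elim: l => [|u l IH] Cl; first by rewrite !big_nil F0.
have Cl' v : v \in l -> C v by move=> vl; apply: Cl; rewrite inE vl orbT.
rewrite !big_cons (le_trans (FD _ _ _ _)) ?lerD2l ?IH//.
- by apply: Cl; rewrite mem_head.
- exact: Csum.
Qed.

(** The head [v] of [vs] takes a share of every entry of [us]; these shares refine [v], and the
    remainders are refined against the tail of [vs]. Subadditivity makes the sums of [F] and of [G]
    grow when entries are split. *)
Lemma common_refinement (F G : W -> R) (us vs : seq W) :
  sublinear_on F -> sublinear_on G ->
  (forall u, u \in us -> C u) -> (forall v, v \in vs -> C v) ->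
  \sum_(u <- us) u = \sum_(v <- vs) v ->
  exists zs : seq W,
    [/\ forall z, z \in zs -> C z, \sum_(z <- zs) z = \sum_(v <- vs) v,
        \sum_(u <- us) F u <= \sum_(z <- zs) F z &
        \sum_(v <- vs) G v <= \sum_(z <- zs) G z].
Proof.
move=> sF sG; elim: vs us => [|v vs IH] us Cus Cvs usvs.
  (* Here [us] sums to 0, so strictness of the cone makes all its entries 0, where [F] vanishes. *)
  exists [::]; split => //; rewrite !big_nil// big_seq big1// => u /Csum_eq0.
  by rewrite big_nil in usvs; move=> ->//; case: sF.
have Cv : C v by apply: Cvs; rewrite mem_head.
have Cvs' w : w \in vs -> C w by move=> wv; apply: Cvs; rewrite inE wv orbT.
move: usvs; rewrite big_cons => usvs.
have [l [Cl usE l1 l2]] := riesz_split_seq Cus Cv (Csum Cvs') usvs.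
have [||zs [Czs zsE Fzs Gzs]] := IH [seq p.2 | p <- l] _ Cvs'.
- by move=> _ /mapP[p /Cl[_ ?] ->].
- by rewrite big_map.
exists ([seq p.1 | p <- l] ++ zs); split.
- by move=> z; rewrite mem_cat => /orP[/mapP[p /Cl[? _] ->]|/Czs].
- by rewrite big_cat/= big_map l1 zsE.
- rewrite big_cat/= usE !big_map (le_trans _ (lerD (lexx _) Fzs))//.
  rewrite big_map -big_split/= big_seq [leRHS]big_seq; apply: ler_sum.
  by move=> p /Cl[? ?]; case: sF => _; exact.
- rewrite !big_cons big_cat/= lerD// -l1 -(big_map fst predT id).
  apply: sublinear_sum => //.
  by move=> _ /mapP[p /Cl[? _] ->].
Qed.

End cone.

(** * Concave envelopes and their additivity over a simplex *)

Section upper_envelope.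
Variables (R : realType) (V : lmodType R) (K : set V).
Implicit Types (g h : K -> R) (x : K) (l : seq (R * K)).

Definition convex_combination x l : Prop :=
  [/\ forall p, p \in l -> 0 <= p.1, \sum_(p <- l) p.1 = 1 &
      \sum_(p <- l) p.1 *: \val p.2 = \val x].

Definition bounded_function g : Prop := exists M, forall x, `|g x| <= M.

(** The intermediate point [z] is a variable, as the subtype [K] carries no convex combinations of
    its own. *)
Definition convex_on g : Prop := forall x y z (t : R), 0 <= t <= 1 ->
  \val z = t *: \val x + (1 - t) *: \val y -> g z <= t * g x + (1 - t) * g y.

Definition concave_envelope g x : R :=
  sup [set \sum_(p <- l) p.1 * g p.2 | l in convex_combination x].

Lemma concave_envelope_le g x M :
  (forall l, convex_combination x l -> \sum_(p <- l) p.1 * g p.2 <= M) ->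
  concave_envelope g x <= M.
Proof.
move=> gM; apply: ge_sup => [|_ [l xl <-]]; last exact: gM.
exists (\sum_(p <- [:: (1, x)]) p.1 * g p.2), [:: (1, x)] => //.
by split; rewrite ?big_seq1 ?scale1r// => p; rewrite inE => /eqP ->.
Qed.

Lemma concave_envelope_ub g x l : bounded_function g -> convex_combination x l ->
  \sum_(p <- l) p.1 * g p.2 <= concave_envelope g x.
Proof.
move=> [M gM] xl; apply: ub_le_sup; last by exists l.
exists M => _ [l' [l'0 l'1 _] <-].
rewrite -[M]mul1r -l'1 mulr_suml big_seq [leRHS]big_seq ler_sum// => p pl.
by rewrite ler_wpM2l ?l'0// (le_trans (ler_norm _)).
Qed.

Lemma concave_envelope_ge g x : bounded_function g -> g x <= concave_envelope g x.
Proof.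
move=> bg; have /(concave_envelope_ub bg) : convex_combination x [:: (1, x)].
  by split; rewrite ?big_seq1 ?scale1r// => p; rewrite inE => /eqP ->.
by rewrite big_seq1 mul1r.
Qed.

Lemma le_concave_envelope g h x : bounded_function h ->
  (forall y, g y <= h y) -> concave_envelope g x <= concave_envelope h x.
Proof.
move=> bh gh; apply: concave_envelope_le => l xl.
apply: le_trans (concave_envelope_ub bh xl).
by case: xl => l0 _ _; rewrite big_seq [leRHS]big_seq ler_sum// => p pl;
  rewrite ler_wpM2l ?l0.
Qed.

Lemma concave_envelope_cst (a : R) x : concave_envelope (cst a) x = a.
Proof.
apply/eqP; rewrite eq_le; apply/andP; split.
  apply: concave_envelope_le => l [_ l1 _].
  by rewrite -mulr_suml l1 mul1r.
by apply: (@concave_envelope_ge (cst a) x); exists `|a|.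
Qed.

Lemma concave_envelopeZ (a : R) g x : bounded_function g -> 0 <= a ->
  concave_envelope (fun y => a * g y) x = a * concave_envelope g x.
Proof.
move=> bg a0; have bag : bounded_function (fun y => a * g y).
  by case: bg => M gM; exists (`|a| * M) => y; rewrite normrM ler_wpM2l.
have sumZ l : \sum_(p <- l) p.1 * (a * g p.2) = a * \sum_(p <- l) p.1 * g p.2.
  by rewrite mulr_sumr; apply: eq_bigr => p _; rewrite mulrCA.
move: a0; rewrite le0r => /predU1P[a0|a0].
  rewrite a0 mul0r -[RHS](concave_envelope_cst 0 x); congr concave_envelope.
  by apply/funext => y; rewrite mul0r.
apply/eqP; rewrite eq_le; apply/andP; split.
  apply: concave_envelope_le => l xl; rewrite sumZ ler_pM2l//.
  exact: concave_envelope_ub.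
rewrite -ler_pdivlMl//; apply: concave_envelope_le => l xl.
by rewrite ler_pdivlMl// -sumZ; exact: concave_envelope_ub.
Qed.

Lemma bounded_functionD g h :
  bounded_function g -> bounded_function h -> bounded_function (fun y => g y + h y).
Proof.
move=> [M gM] [N hN]; exists (M + N) => y.
by rewrite (le_trans (ler_normD _ _))// lerD.
Qed.

Lemma concave_envelopeD_le g h x : bounded_function g -> bounded_function h ->
  concave_envelope (fun y => g y + h y) x <=
  concave_envelope g x + concave_envelope h x.
Proof.
move=> bg bh; apply: concave_envelope_le => l xl.
under eq_bigr do rewrite mulrDr.
by rewrite big_split/= lerD// concave_envelope_ub.
Qed.

(** * Points of K as elements of a base of a lattice cone *)

Section cone_coordinates.
Variables (W : lmodType R) (C : set W) (phi : K -> W) (x0 : K).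
Hypothesis latC : lattice_cone C.
Hypothesis phi_cone : forall x, C (phi x).
Hypothesis phi_neq0 : forall x, phi x <> 0.
Hypothesis phi_onto : forall y, C y -> y <> 0 ->
  exists2 p : R * K, 0 < p.1 & y = p.1 *: phi p.2.
Hypothesis phi_inj : forall (a b : R) x y, 0 < a -> 0 < b ->
  a *: phi x = b *: phi y -> a = b /\ x = y.
Hypothesis phi_conv : forall x y (t : R), 0 <= t <= 1 -> exists2 z : K,
  \val z = t *: \val x + (1 - t) *: \val y &
  phi z = t *: phi x + (1 - t) *: phi y.

Let cone_ex y : C y -> exists2 p : R * K, 0 <= p.1 & y = p.1 *: phi p.2.
Proof.
move=> Cy; have [->|/eqP y0] := eqVneq y 0.
  by exists (0, x0) => //=; rewrite scale0r.
by have [p p0 ->] := phi_onto Cy y0; exists p => //; exact: ltW.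
Qed.

(** The merged point has weights [a / (a + b)] and [b / (a + b)], simultaneously in [V] and in the
    cone. If both weights vanish, any point serves, here [x0]. *)
Let phi_merge (a b : R) x y : 0 <= a -> 0 <= b -> exists z : K,
  [/\ (a + b) *: phi z = a *: phi x + b *: phi y,
      (a + b) *: \val z = a *: \val x + b *: \val y &
      forall g, convex_on g -> (a + b) * g z <= a * g x + b * g y].
Proof.
move=> a0 b0; have := addr_ge0 a0 b0; rewrite le0r => /predU1P[ab0|ab0].
  have /andP[/eqP -> /eqP ->] : (a == 0) && (b == 0).
    by rewrite -paddr_eq0// ab0.
  by exists x0; split=> [||g _]; rewrite ?addr0 ?scale0r ?mul0r ?addr0.
have t01 : 0 <= a / (a + b) <= 1.
  by rewrite divr_ge0 ?(ltW ab0)//= ler_pdivrMr// mul1r lerDl.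
have abt : (a + b) * (a / (a + b)) = a by rewrite mulrC divfK// gt_eqF.
have abt' : (a + b) * (1 - a / (a + b)) = b.
  by rewrite mulrBr mulr1 abt addrAC subrr add0r.
have [z zv zphi] := phi_conv x y t01.
exists z; split=> [||g cg].
- by rewrite zphi scalerDr !scalerA abt abt'.
- by rewrite zv scalerDr !scalerA abt abt'.
- have : (a + b) * g z <=
      (a + b) * (a / (a + b) * g x + (1 - a / (a + b)) * g y).
    by rewrite ler_pM2l//; exact: cg.
  by rewrite mulrDr [_ * (a / _ * _)]mulrA [_ * ((1 - _) * _)]mulrA abt abt'.
Qed.

Let phi_sum l : (forall p, p \in l -> 0 <= p.1) -> exists (a : R) (z : K),
  [/\ 0 <= a, \sum_(p <- l) p.1 = a,
      \sum_(p <- l) p.1 *: \val p.2 = a *: \val z &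
      \sum_(p <- l) p.1 *: phi p.2 = a *: phi z].
Proof.
elim: l => [|p l IH] l0.
  by exists 0, x0; rewrite !big_nil !scale0r.
have [|a [z [a0 sa sv sphi]]] := IH.
  by move=> q ql; apply: l0; rewrite inE ql orbT.
have p0 : 0 <= p.1 by apply: l0; rewrite mem_head.
have [w [wphi wv _]] := phi_merge p.2 z p0 a0.
exists (p.1 + a), w; rewrite !big_cons sa sv sphi wphi wv.
by split => //; exact: addr_ge0.
Qed.

(** This transfers combinations from [V] to the cone. The total weight is not prescribed on the cone
    side: uniqueness of base coordinates recovers that it is 1. *)
Let convex_combination_phi x l : (forall p, p \in l -> 0 <= p.1) ->
  convex_combination x l <-> \sum_(p <- l) p.1 *: phi p.2 = phi x.
Proof.
move=> l0; have [a [z [a0 sa sv sphi]]] := phi_sum l0.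
split=> [[_ l1 lx]|].
  by rewrite sphi -sa l1 scale1r; congr phi; apply: val_inj;
    rewrite -lx sv -sa l1 scale1r.
rewrite sphi => azx; have a1 : 0 < a.
  rewrite lt_neqAle a0 andbT; apply/eqP => a00.
  by apply: (@phi_neq0 x); rewrite -azx -a00 scale0r.
have [a1E zx] : a = 1 /\ z = x.
  by apply: phi_inj => //; rewrite scale1r.
by split; rewrite ?sv ?sa ?a1E ?zx ?scale1r.
Qed.

(** The positively homogeneous extension of [g] from the base to the cone. The default pair has
    weight 0, so the value at 0 is 0. *)
Let hext g (y : W) : R :=
  let p := xget (0, x0) [set p : R * K | 0 < p.1 /\ y = p.1 *: phi p.2] in
  p.1 * g p.2.

Let hextE g (a : R) x : 0 <= a -> hext g (a *: phi x) = a * g x.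
Proof.
rewrite le0r => /predU1P[->|a0]; rewrite /hext.
  rewrite scale0r xgetPN ?mul0r// => -[b y]/= [b0 /eqP].
  by rewrite eq_sym scaler_eq0 gt_eqF//= => /eqP; exact: phi_neq0.
have [b0 E] := @xgetPex _ (0, x0)
  [set p : R * K | 0 < p.1 /\ a *: phi x = p.1 *: phi p.2] (ex_intro _ (a, x)
  (conj a0 erefl)).
by have [<- <-] := phi_inj a0 b0 E.
Qed.

Let hext_sublinear g : convex_on g -> sublinear_on C (hext g).
Proof.
move=> cg; split; first by rewrite -(scale0r (phi x0)) hextE// mul0r.
move=> _ _ /cone_ex[[a x] /= a0 ->] /cone_ex[[b y] /= b0 ->].
have [z [<- _ zg]] := phi_merge x y a0 b0.
by rewrite !hextE ?addr_ge0// zg.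
Qed.

(** For the nontrivial inequality, combinations [l1] and [l2] of [x] become two decompositions of
    [phi x]. A common refinement, read back as a combination [l3] of [x], does at least as well as
    [l1] for [g] and as [l2] for [h]. *)
Lemma concave_envelopeD_cone g h x :
  bounded_function g -> bounded_function h -> convex_on g -> convex_on h ->
  concave_envelope (fun y => g y + h y) x =
  concave_envelope g x + concave_envelope h x.
Proof.
move=> bg bh cg ch; apply/eqP; rewrite eq_le concave_envelopeD_le//=.
rewrite -lerBrDr; apply: concave_envelope_le => l1 xl1.
rewrite lerBrDr -lerBrDl; apply: concave_envelope_le => l2 xl2.
rewrite lerBrDl.
pose us l := [seq p.1 *: phi p.2 | p <- l].
have Cus l : (forall p, p \in l -> 0 <= p.1) -> forall u, u \in us l -> C u.
  move=> l0 _ /mapP[p /l0 p0 ->]; case: latC => -[[_ CZ] _] _.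
  by have := CZ _ 0 _ _ p0 (lexx 0) (phi_cone p.2) (phi_cone p.2);
    rewrite scale0r addr0.
have usE l : convex_combination x l -> \sum_(u <- us l) u = phi x.
  by move=> xl; rewrite big_map; apply/convex_combination_phi => //; case: xl.
have hextl f l : (forall p, p \in l -> 0 <= p.1) ->
    \sum_(u <- us l) hext f u = \sum_(p <- l) p.1 * f p.2.
  move=> l0; rewrite big_map big_seq [RHS]big_seq.
  by apply: eq_bigr => p /l0 p0; rewrite hextE.
have [l10 _ _] := xl1; have [l20 _ _] := xl2.
have [|zs [Czs zsE gzs hzs]] := common_refinement latC (hext_sublinear cg)
  (hext_sublinear ch) (Cus _ l10) (Cus _ l20).
  by rewrite !usE.
(* Each cone element is read back as a weighted point, 0 being given weight 0 at [x0]. *)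
have [l3 [l30 zsl3]] : exists l, (forall p, p \in l -> 0 <= p.1) /\ zs = us l.
  elim: zs Czs {zsE gzs hzs} => [|z zs IH] Czs; first by exists [::].
  have [|l [l0 ->]] := IH.
    by move=> w wz; apply: Czs; rewrite inE wz orbT.
  have [p p0 ->] := cone_ex (Czs _ (mem_head _ _)).
  by exists (p :: l); split => // q; rewrite inE => /predU1P[->|/l0].
move: gzs hzs; rewrite zsl3 !hextl// => gl3 hl3.
have xl3 : convex_combination x l3.
  apply/convex_combination_phi => //.
  by move: zsE; rewrite zsl3 (usE l2)// big_map.
apply: le_trans (concave_envelope_ub (bounded_functionD bg bh) xl3).
rewrite [leRHS](eq_bigr (fun p => p.1 * g p.2 + p.1 * h p.2)) => [|p _].
  by rewrite big_split/= lerD.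
by rewrite mulrDr.
Qed.

End cone_coordinates.

Lemma concave_envelope_simplexD g h x : simplex K ->
  bounded_function g -> bounded_function h -> convex_on g -> convex_on h ->
  concave_envelope (fun y => g y + h y) x =
  concave_envelope g x + concave_envelope h x.
Proof.
move=> [cK [W [C [B [f [latC [BC cB CB] [fKB finj fsurj] faff]]]]]] bg bh cg ch.
have KP (y : K) : K (\val y) by case: y => y /= /set_mem.
(* A base may contain 0. A nonzero [b] in it would then be a multiple of both base points [b] and
   [2^-1 *: b], against uniqueness; so [B], and with it [K], is a single point. Otherwise the cone
   coordinates apply. *)
have [B0|B0] := pselect (B 0).
  have B00 b : B b -> b = 0.
    move=> Bb; apply: contrapT => b0.
    have Bb2 : B (2^-1 *: b).
      have h0 : 0 <= 2^-1 :> R by lra.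
      have h1 : 2^-1 <= 1 :> R by lra.
      have := cB b 0 (Itv01 h0 h1) (mem_set Bb) (mem_set B0).
      move=> /set_mem; congr B; rewrite /conv/= scaler0 addr0//.
    have [p [_ pU]] := CB b (BC _ Bb) b0.
    have p1 : p = (1, b) by apply: pU; rewrite /= scale1r.
    have : p = (2, 2^-1 *: b).
      by apply: pU; split => //=; rewrite scalerA divff// scale1r.
    by rewrite p1 => -[E _]; have : (1 : R) = 2 := E; lra.
  have Kx (y : K) : y = x.
    apply: val_inj; apply: finj; [exact/mem_set|exact/mem_set|].
    have fv0 (z : K) : f (\val z) = 0 := B00 _ (fKB _ (KP z)).
    by rewrite fv0 fv0.
  have envE k : concave_envelope k x = k x.
    apply/eqP; rewrite eq_le; apply/andP; split.
      apply: concave_envelope_le => l [_ l1 _].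
      rewrite (eq_bigr (fun p => p.1 * k x)) => [|p _]; last by rewrite (Kx p.2).
      by rewrite -mulr_suml l1 mul1r.
    by apply: concave_envelope_ge; exists `|k x| => y; rewrite (Kx y).
  by rewrite !envE.
apply: (@concave_envelopeD_cone W C (fun y => f (\val y))) => //.
- by move=> y; exact: (BC _ (fKB _ (KP y))).
- by move=> y fy0; apply: B0; rewrite -fy0; exact: (fKB _ (KP y)).
- move=> y Cy y0; have [[a b] [[/= a0 Bb yab] _]] := CB y Cy y0.
  have [v Kv vb] := fsurj b Bb.
  by exists (a, exist _ v (mem_set Kv)) => //=; rewrite vb.
- move=> a b y z a0 b0 E.
  have Cy : C (a *: f (\val y)).
    case: latC => -[[_ CZ] _] _; have Cfy := BC _ (fKB _ (KP y)).
    by have := CZ a 0 _ _ (ltW a0) (lexx 0) Cfy Cfy; rewrite scale0r addr0.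
  have y0 : a *: f (\val y) <> 0.
    move/eqP; rewrite scaler_eq0 gt_eqF//= => /eqP fy0.
    by apply: B0; rewrite -fy0; exact: (fKB _ (KP y)).
  have [p [_ pU]] := CB _ Cy y0.
  have : p = (a, f (\val y)) by apply: pU; split => //; exact: (fKB _ (KP _)).
  have -> : p = (b, f (\val z)) by apply: pU; split => //; exact: (fKB _ (KP _)).
  move=> [-> fzy]; split => //; apply: val_inj.
  exact: (finj _ _ (mem_set (KP _)) (mem_set (KP _))).
- move=> y z t /andP[t0 t1].
  pose t' : {i01 R} := Itv01 t0 t1.
  have Kyz := cK (\val y) (\val z) t' (mem_set (KP y)) (mem_set (KP z)).
  exists (exist _ (t *: \val y + (1 - t) *: \val z) Kyz) => //.
  exact: (faff t' _ _ (mem_set (KP y)) (mem_set (KP z))).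
Qed.

End upper_envelope.

(** * Convex continuous functions on the state space *)

(** A filter on the subtype is pushed forward to [X]; it clusters at a point of [A], and open sets
    of the subtype are traces of open sets of [X]. *)
Lemma compact_subtype (X : topologicalType) (A : set X) :
  compact A -> compact [set: A].
Proof.
move=> cA F PF _; pose G := (\val : A -> X) @ F.
have [|p [Ap clp]] := cA G.
  apply: (@filterS _ F _ setT); last exact: filterT.
  by move=> [x /= xA] _; exact: set_mem.
exists (exist _ p (mem_set Ap)); split => // U B FU [_ [[W oW <-] /= Wp WB]].
have [||_ [[z Uz <-] Wz]] := clp (\val @` U) W.
- by apply: (@filterS _ F _ U) => // z Uz; exists z.
- exact: open_nbhs_nbhs.
by exists z; split => //; exact: WB.
Qed.

Section real_continuous.
Variables (R : realType) (T : topologicalType).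
Implicit Types f g : T -> R.

Lemma real_continuousD f g :
  continuous f -> continuous g -> continuous (fun x => f x + g x).
Proof. by move=> cf cg x; exact: (@continuousD R R^o T f g x (cf x) (cg x)). Qed.

Lemma real_continuousB f g :
  continuous f -> continuous g -> continuous (fun x => f x - g x).
Proof. by move=> cf cg x; exact: (@continuousB R R^o T f g x (cf x) (cg x)). Qed.

Lemma real_continuousZ (a : R) f :
  continuous f -> continuous (fun x => a * f x).
Proof.
by move=> cf x; exact: (@continuousM R T (cst a) f x (@cst_continuous _ _ a x) (cf x)).
Qed.

End real_continuous.

Section state_space.
Variables (R : realType) (E : effectAlgType).
Local Notation K := (state_space R E).

Lemma coord_continuous (a : E) : continuous (fun f : {ptws E -> R^o} => f a).
Proof. exact: (@proj_continuous E (fun=> R^o) a). Qed.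

(** The conditions on a state cut a closed subset out of the cube of maps into [0, 1], which is
    compact by Tychonoff. *)
Lemma state_space_compact : compact K.
Proof.
have -> : K = [set f : {ptws E -> R^o} | forall a, `[0, 1]%classic (f a)] `&`
    ([set f | f pone = 1] `&`
     \bigcap_(t in [set t : E * E * E | psum t.1.1 t.1.2 = Some t.2])
       [set f | f t.2 - (f t.1.1 + f t.1.2) = 0]).
  apply/seteqP; split=> f /=.
    move=> [f01 f1 fD]; split=> [a|]; first by rewrite in_itv/= f01.
    by split=> // -[[a b] c] /= /fD ->; rewrite subrr.
  move=> [f01 [f1 fD]]; split=> // a b c abc.
  by apply/eqP; rewrite -subr_eq0; apply/eqP; exact: (fD (a, b, c)).
apply: compact_closedI.
  apply: (@tychonoff E (fun=> R^o) (fun=> `[0, 1]%classic)) => _.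
  exact: segment_compact.
apply: closedI.
  rewrite (_ : mkset _ = (fun f : {ptws E -> R^o} => f pone) @^-1` [set y | y = 1])//.
  by apply: closed_comp => [f _|]; [exact: coord_continuous|exact: closed_eq].
apply: closed_bigI => -[[a b] c] /= _.
rewrite (_ : mkset _ = (fun f : {ptws E -> R^o} => f c - (f a + f b)) @^-1`
  [set y | y = 0])//.
apply: closed_comp => [f _|]; last exact: closed_eq.
apply: real_continuousB; first exact: coord_continuous.
by apply: real_continuousD; exact: coord_continuous.
Qed.

Lemma state_coord_continuous (a : E) : continuous (fun x : K => \val x a : R).
Proof.
move=> x; apply: (@continuous_comp K {ptws E -> R^o} R^o \val (fun f => f a)).
  exact: initial_continuous.
exact: coord_continuous.
Qed.

Definition convex_continuous : set (K -> R) :=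
  [set f | continuous f /\ convex_on f].

Definition convex_difference : set (K -> R) :=
  [set h | exists f g, [/\ convex_continuous f, convex_continuous g &
    h = fun x => f x - g x]].

Let CC := convex_continuous.

Lemma convex_continuous_cst (a : R) : CC (cst a).
Proof.
split=> [x|x y z t _ _]; first exact: cst_continuous.
by rewrite /cst -mulrDl addrC subrK mul1r.
Qed.

Lemma convex_continuousD f g : CC f -> CC g -> CC (fun x => f x + g x).
Proof.
move=> [cf vf] [cg vg]; split=> [|x y z t t01 zE]; first exact: real_continuousD.
have := vf x y z t t01 zE; have := vg x y z t t01 zE; lra.
Qed.

Lemma convex_continuousZ (a : R) f : 0 <= a -> CC f -> CC (fun x => a * f x).
Proof.
move=> a0 [cf vf]; split=> [|x y z t t01 zE]; first exact: real_continuousZ.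
by have := ler_wpM2l a0 (vf x y z t t01 zE); lra.
Qed.

Lemma convex_continuous_max f g :
  CC f -> CC g -> CC (fun x => Num.max (f x) (g x)).
Proof.
move=> [cf vf] [cg vg]; split=> [x|x y z t t01 zE].
  by apply: (@continuous_max _ _ f g); [exact: cf|exact: cg].
have /andP[t0 t1] := t01; have t1' : 0 <= 1 - t by lra.
have lem (h : K -> R) : h z <= t * h x + (1 - t) * h y ->
    (forall w, h w <= Num.max (f w) (g w)) ->
    h z <= t * Num.max (f x) (g x) + (1 - t) * Num.max (f y) (g y).
  by move=> hz hm; rewrite (le_trans hz)// lerD// ler_wpM2l.
by rewrite ge_max !lem ?vf ?vg// => w; rewrite le_max lexx ?orbT.
Qed.

Lemma convex_continuous_dist (a : E) (c : R) : CC (fun x => `|\val x a - c|).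
Proof.
split=> [|x y z t /andP[t0 t1] zE].
  move=> x; apply: (@continuous_comp _ R^o R^o (fun x : K => \val x a - c) Num.norm).
    apply: real_continuousB; first exact: state_coord_continuous.
    exact: cst_continuous.
  exact: norm_continuous.
have -> : \val z a - c = t * (\val x a - c) + (1 - t) * (\val y a - c).
  by rewrite zE; rewrite -[LHS]/(t * \val x a + (1 - t) * \val y a - c); ring.
have t1' : 0 <= 1 - t by lra.
by rewrite (le_trans (ler_normD _ _))// !normrM (ger0_norm t0) (ger0_norm t1').
Qed.

Lemma convex_continuous_bounded f : CC f -> bounded_function f.
Proof.
move=> [cf _].
by apply: continuous_bounded cf; exact: compact_subtype state_space_compact.
Qed.

(** A continuous convex substitute for a metric, built from the seminorms of pointwise
    convergence. *)
Definition weighted_dist (l : seq (R * E)) (x y : K) : R :=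
  \sum_(p <- l) p.1 * `|\val y p.2 - \val x p.2|.

Lemma weighted_dist_refl l x : weighted_dist l x x = 0.
Proof.
by rewrite /weighted_dist big1// => p _; rewrite subrr normr0 mulr0.
Qed.

Lemma weighted_dist_convex l x : (forall p, p \in l -> 0 <= p.1) ->
  CC (weighted_dist l x).
Proof.
elim: l => [|p l IH] l0.
  rewrite (_ : weighted_dist _ _ = cst 0); first exact: convex_continuous_cst.
  by apply/funext => y; rewrite /weighted_dist big_nil.
rewrite (_ : weighted_dist _ _ = fun y => p.1 * `|\val y p.2 - \val x p.2| +
  weighted_dist l x y); last first.
  by apply/funext => y; rewrite /weighted_dist big_cons.
apply: convex_continuousD.
  apply: convex_continuousZ; first by apply: l0; rewrite mem_head.
  exact: convex_continuous_dist.
by apply: IH => q ql; apply: l0; rewrite inE ql orbT.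
Qed.

Lemma weighted_dist_sep (O : set K) x : open O -> O x ->
  exists l, (forall p, p \in l -> 0 <= p.1) /\
    forall y, ~ O y -> 1 <= weighted_dist l x y.
Proof.
move=> oO Ox.
have cC : compact (~` O).
  apply: (subclosed_compact (open_closedC oO) _ (@subsetT _ _)).
  exact: compact_subtype state_space_compact.
pose U (p : R * E) := [set y : K | 1 < p.1 * `|\val y p.2 - \val x p.2|].
have [||s s0 sO] := compact_finite_cover x cC (D := [set p | 0 <= p.1]) (f := U).
- move=> p p0; rewrite /U.
  rewrite (_ : mkset _ = (fun y : K => p.1 * `|\val y p.2 - \val x p.2|) @^-1`
    [set r | 1 < r])//.
  have [cf _] := convex_continuousZ p0 (convex_continuous_dist p.2 (\val x p.2)).
  by apply: open_comp => [y _|]; [exact: cf|exact: open_gt].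
- move=> y Oy; have /eqP yx : y <> x by move=> yx; apply: Oy; rewrite yx.
  have [a yxa] : exists a, \val y a != \val x a.
    apply: contrapT => /forallNP yxa; move/eqP: yx; apply.
    by apply: val_inj; apply/funext => a; apply/eqP/negPn/negP; exact: yxa.
  have d0 : 0 < `|\val y a - \val x a| by rewrite normr_gt0 subr_eq0.
  (* With this weight the term equals 2 at [y], so it exceeds 1 nearby. *)
  exists (2 / `|\val y a - \val x a|, a) => /=; first by rewrite divr_ge0.
  by rewrite /U/= divfK ?gt_eqF//; lra.
exists (finmap.enum_fset s); split=> [p ps|y Oy].
  by have := s0 p ps; rewrite inE.
have [p /= ps /ltW yp] := sO y Oy; rewrite (le_trans yp)// /weighted_dist.
rewrite (bigD1_seq p ps (finmap.fset_uniq s))/= lerDl.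
rewrite big_seq_cond sumr_ge0// => q /andP[qs _].
by rewrite mulr_ge0//; have := s0 q qs; rewrite inE.
Qed.

Lemma convex_difference_lattice : urysohn_lattice convex_difference.
Proof.
split.
- exists (cst 1), (cst 0); split; try exact: convex_continuous_cst.
  by apply/funext => x; rewrite /= subr0.
- move=> _ [f [g [[cf _] [cg _] ->]]].
  exact: real_continuousB.
- move=> a _ _ [f1 [g1 [Sf1 Sg1 ->]]] [f2 [g2 [Sf2 Sg2 ->]]].
  have [a0|a0] := leP 0 a.
    exists (fun x => a * f1 x + f2 x), (fun x => a * g1 x + g2 x).
    split; try by apply: convex_continuousD => //; exact: convex_continuousZ.
    by apply/funext => x; ring.
  (* A negative scalar exchanges the roles of the two convex parts. *)
  have a0' : 0 <= - a by lra.
  exists (fun x => - a * g1 x + f2 x), (fun x => - a * f1 x + g2 x).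
  split; try by apply: convex_continuousD => //; exact: convex_continuousZ.
  by apply/funext => x; ring.
- move=> _ _ [f1 [g1 [Sf1 Sg1 ->]]] [f2 [g2 [Sf2 Sg2 ->]]].
  (* Adding [g1 + g2] to both arguments of the maximum makes them convex. *)
  exists (fun x => Num.max (f1 x + g2 x) (f2 x + g1 x)), (fun x => g1 x + g2 x).
  split; [|exact: convex_continuousD|].
    by apply: convex_continuous_max; exact: convex_continuousD.
  apply/funext => x; rewrite -[RHS]/(Num.max _ _ - _).
  case: (leP (f1 x - g1 x) (f2 x - g2 x));
    case: (leP (f1 x + g2 x) (f2 x + g1 x)); lra.
- move=> O x oO Ox; have [l [l0 lO]] := weighted_dist_sep oO Ox.
  have Sq := weighted_dist_convex x l0.
  (* This is the positive part of [1 - weighted_dist l x], which is 1 at [x] and 0 off [O]. *)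
  exists (fun y => Num.max 1 (weighted_dist l x y) - weighted_dist l x y); split.
  + exists (fun y => Num.max 1 (weighted_dist l x y)), (weighted_dist l x).
    split => //; apply: convex_continuous_max Sq.
    exact: convex_continuous_cst.
  + move=> y; rewrite indicE.
    have q0 : 0 <= weighted_dist l x y.
      by rewrite /weighted_dist big_seq sumr_ge0// => p /l0 p0; rewrite mulr_ge0.
    have [_|] := boolP (y \in O); first by case: (leP 1 (weighted_dist l x y)) => /=; lra.
    by rewrite notin_setE => /lO ?; case: (leP 1 (weighted_dist l x y)) => /=; lra.
  + by rewrite weighted_dist_refl subr0; apply/max_idPl.
Qed.

End state_space.

(** * The functional of concave envelopes *)

Section envelope_functional.
Variables (R : realType) (E : effectAlgType).
Local Notation K := (state_space R E).
Local Notation CC := (@convex_continuous R E).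
Hypothesis S_simplex : simplex (state_space R E).
Variable s : K.

(** The decomposition of [h] is chosen arbitrarily; [envelope_functionalE] shows that the choice
    does not matter. *)
Definition envelope_functional (h : K -> R) : R :=
  let p := xget (cst 0, cst 0) [set p : (K -> R) * (K -> R) |
    [/\ CC p.1, CC p.2 & h = fun x => p.1 x - p.2 x]] in
  concave_envelope p.1 s - concave_envelope p.2 s.

Let envD f g : CC f -> CC g -> concave_envelope (fun x => f x + g x) s =
  concave_envelope f s + concave_envelope g s.
Proof.
move=> cf cg; apply: concave_envelope_simplexD => //;
  try exact: convex_continuous_bounded.
- by case: cf.
- by case: cg.
Qed.

(** Two decompositions [f - g = p.1 - p.2] give [f + p.2 = p.1 + g], an identity of convex
    functions, on which the envelope is additive. *)
Lemma envelope_functionalE f g : CC f -> CC g ->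
  envelope_functional (fun x => f x - g x) =
  concave_envelope f s - concave_envelope g s.
Proof.
move=> cf cg; rewrite /envelope_functional.
have := @xgetPex _ (cst 0, cst 0) [set p : (K -> R) * (K -> R) |
    [/\ CC p.1, CC p.2 & (fun x => f x - g x) = fun x => p.1 x - p.2 x]].
case/(_ (ex_intro _ (f, g) (And3 cf cg erefl))).
set p := xget _ _ => c1 c2 fgE.
apply/eqP; rewrite subr_eq addrAC eq_sym subr_eq -!envD//; apply/eqP.
congr concave_envelope; apply/funext => x.
by have := congr1 (fun k => k x) fgE => /=; lra.
Qed.

Lemma envelope_functional_positive :
  positive_functional (@convex_difference R E) envelope_functional.
Proof.
have envZ a f : 0 <= a -> CC f ->
    concave_envelope (fun x => a * f x) s = a * concave_envelope f s.
  by move=> a0 cf; apply: concave_envelopeZ => //; exact: convex_continuous_bounded.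
split.
- have c0 := convex_continuous_cst E (0 : R).
  have c1 := convex_continuous_cst E (1 : R).
  have -> : cst 1 = (fun x => cst 1 x - cst 0 x) :> (K -> R).
    by apply/funext => x /=; rewrite subr0.
  by rewrite envelope_functionalE// !concave_envelope_cst subr0.
- move=> a _ _ [f1 [g1 [cf1 cg1 ->]]] [f2 [g2 [cf2 cg2 ->]]].
  rewrite !envelope_functionalE//.
  have [a0|a0] := leP 0 a.
    have caf := convex_continuousZ a0 cf1; have cag := convex_continuousZ a0 cg1.
    rewrite [X in envelope_functional X](_ : _ =
      fun x => (a * f1 x + f2 x) - (a * g1 x + g2 x)); last first.
      by apply/funext => x; ring.
    rewrite envelope_functionalE; try exact: convex_continuousD.
    by rewrite !envD// !envZ//; ring.
  have a0' : 0 <= - a by lra.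
  have caf := convex_continuousZ a0' cf1; have cag := convex_continuousZ a0' cg1.
  rewrite [X in envelope_functional X](_ : _ =
    fun x => (- a * g1 x + f2 x) - (- a * f1 x + g2 x)); last first.
    by apply/funext => x; ring.
  rewrite envelope_functionalE; try exact: convex_continuousD.
  by rewrite !envD// !envZ//; ring.
- move=> _ _ [f1 [g1 [cf1 cg1 ->]]] [f2 [g2 [cf2 cg2 ->]]] fg.
  (* Moving the subtracted parts across turns the claim into monotonicity of the envelope between
     [f1 + g2] and [f2 + g1]. *)
  rewrite !envelope_functionalE// lerBlDr addrAC lerBrDr -!envD//.
  apply: le_concave_envelope => [|x]; last by have := fg x; lra.
  by apply: convex_continuous_bounded; exact: convex_continuousD.
Qed.

End envelope_functional.

(** * Barycentres, and the bound of integrals by the envelope *)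

Section barycentre.
Variables (R : realType) (E : effectAlgType).
Local Notation K := (state_space R E).
Variable s : K.
Variable nu : {finite_measure set (borel s) -> \bar R}.

Let cK : compact [set: K].
Proof. exact: compact_subtype (@state_space_compact R E). Qed.

Let mass (A : set K) : R := fine (nu A).

Let int_cont (A : set (borel s)) (f : K -> R) : measurable A -> continuous f ->
  nu.-integrable A (EFin \o f).
Proof. exact: continuous_integrable. Qed.

Let cstE (A : set (borel s)) (c : R) : measurable A ->
  \int[nu]_(x in A) c = c * mass A.
Proof. by move=> mA; rewrite Rintegral_cst. Qed.

(** The barycentre is the coordinatewise average over [A]: bounds, normalisation and additivity of
    states survive integration. *)
Lemma barycentre_exists (A : set (borel s)) : measurable A -> 0 < mass A ->
  exists b : K, forall a, \int[nu]_(x in A) \val (x : K) a = mass A * \val b a.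
Proof.
move=> mA A0.
pose m (a : E) : R := (mass A)^-1 * \int[nu]_(x in A) \val (x : K) a.
have ca a : nu.-integrable A (EFin \o (fun x : K => \val x a)).
  by apply: int_cont => //; exact: state_coord_continuous.
have st (x : K) : is_state (\val x : E -> R) by case: x => x /= /set_mem.
have mK : K m.
  split.
  - move=> a; rewrite /m; apply/andP; split.
      rewrite mulr_ge0 ?invr_ge0 ?(ltW A0)//; apply: Rintegral_ge0 => x _.
      by have [/(_ a)/andP[]] := st x.
    rewrite mulrC ler_pdivrMr// mul1r -[leRHS]mul1r -cstE//.
    apply: le_Rintegral => //; first by apply: int_cont => //; exact: cst_continuous.
    by move=> x _; have [/(_ a)/andP[]] := st x.
  - rewrite /m (@eq_Rintegral _ _ _ nu A (fun=> 1)) => [|x _]; last by have [_ ->] := st x.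
    by rewrite cstE// mul1r mulVf// gt_eqF.
  - move=> a b c abc; rewrite /m -mulrDr -RintegralD//; congr (_ * _).
    by apply: eq_Rintegral => x _; have [_ _ /(_ _ _ _ abc)] := st x.
exists (exist _ m (mem_set mK)) => a /=.
by rewrite /m mulrA divff ?mul1r// gt_eqF.
Qed.

(** Jensen's inequality for [weighted_dist], proved term by term from the bound of the absolute
    value of an integral. *)
Let weighted_dist_barycentre (A : set (borel s)) (b x : K) (l : seq (R * E)) :
  measurable A -> (forall p, p \in l -> 0 <= p.1) ->
  (forall a, \int[nu]_(z in A) \val (z : K) a = mass A * \val b a) ->
  mass A * weighted_dist l x b <= \int[nu]_(z in A) weighted_dist l x (z : K).
Proof.
move=> mA + bA; have m0 : 0 <= mass A by exact: fine_ge0.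
elim: l => [_|p l IH l0].
  by rewrite /weighted_dist big_nil mulr0; apply: Rintegral_ge0 => z _; rewrite big_nil.
have p0 : 0 <= p.1 by apply: l0; rewrite mem_head.
have l0' q : q \in l -> 0 <= q.1 by move=> ql; apply: l0; rewrite inE ql orbT.
have [cd _] := @convex_continuous_dist R E p.2 (\val x p.2).
have [cl _] := weighted_dist_convex x l0'.
have consE z : weighted_dist (p :: l) x z =
    p.1 * `|\val z p.2 - \val x p.2| + weighted_dist l x z.
  by rewrite /weighted_dist big_cons.
rewrite (@eq_Rintegral _ _ _ nu A (fun z : K =>
  p.1 * `|\val z p.2 - \val x p.2| + weighted_dist l x z)) => [|z _]; last exact: consE.
rewrite consE RintegralD//; last exact: int_cont.
  rewrite mulrDr lerD ?IH// RintegralZl//; last exact: int_cont.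
  rewrite mulrCA ler_wpM2l// -{1}(ger0_norm m0) -normrM mulrBr -bA mulrC -cstE//.
  have cz := @state_coord_continuous R E p.2.
  rewrite -RintegralB//; [|exact: int_cont|].
    apply: le_normr_Rintegral => //; apply: int_cont => //.
    by apply: real_continuousB => //; exact: cst_continuous.
  by apply: int_cont => //; exact: cst_continuous.
by apply: int_cont => //; exact: real_continuousZ.
Qed.

(* The sets on which [f] exceeds its value at the barycentre of any of their
   non-negligible subsets by at most [e]. *)
Let good (f : K -> R) (e : R) : set (set K) := [set U | open U /\
  forall (A : set (borel s)) (b : K), measurable A -> A `<=` U -> 0 < mass A ->
    (forall a, \int[nu]_(x in A) \val (x : K) a = mass A * \val b a) ->
    forall x, A x -> f x <= f b + e].

(** Near [x], [f] varies by less than [e / 2] on an open [O], off which some [weighted_dist] is at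
    least 1. On subsets of the part of [O] where it is below 1/2, Jensen keeps it at most 1/2 at the
    barycentre, which therefore stays in [O]. *)
Let good_nbhs f e x : continuous f -> 0 < e ->
  exists2 U, good f e U & U x.
Proof.
move=> cf e0; pose O := [set y | `|f y - f x| < e / 2].
have oO : open O.
  rewrite (_ : O = (fun y => f y - f x) @^-1` [set r | `|r| < e / 2])//.
  apply: open_comp => [y _|].
    by apply: real_continuousB => //; exact: cst_continuous.
  rewrite (_ : mkset _ = (@Num.norm R R) @^-1` [set r | r < e / 2])//.
  by apply: open_comp => [y _|]; [exact: norm_continuous|exact: open_lt].
have Ox : O x by rewrite /O/= subrr normr0 divr_gt0.
have [l [l0 lO]] := weighted_dist_sep oO Ox.
pose U := O `&` [set y | weighted_dist l x y < 1 / 2].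
have [cq _] := weighted_dist_convex x l0.
exists U; last by split => //=; rewrite weighted_dist_refl; lra.
split.
  apply: openI => //.
  rewrite (_ : mkset _ = (weighted_dist l x) @^-1` [set r | r < 1 / 2])//.
  by apply: open_comp => [y _|]; [exact: cq|exact: open_lt].
move=> A b mA AU A0 bA y Ay.
suff Ob : O b.
  have [+ _] := AU y Ay; move: Ob; rewrite /O/= !ltr_distl => /andP[? ?] /andP[? ?].
  lra.
apply: contrapT => /lO; apply/negP; rewrite -ltNge.
have dq : mass A * weighted_dist l x b <=
    \int[nu]_(z in A) weighted_dist l x (z : K).
  exact: weighted_dist_barycentre.
have : \int[nu]_(z in A) weighted_dist l x (z : K) <= 1 / 2 * mass A.
  rewrite -cstE//; apply: le_Rintegral => //; first exact: int_cont.
    by apply: int_cont => //; exact: cst_continuous.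
  by move=> z Az; have [_ /ltW] := AU z Az.
move=> /(le_trans dq); rewrite mulrC ler_pM2r//; lra.
Qed.

Lemma le_concave_envelope_integral (f : K -> R) :
  (forall a, \int[nu]_x \val (x : K) a = \val s a) -> convex_continuous f ->
  \int[nu]_x f x <= concave_envelope f s.
Proof.
move=> nus Cf; have [cf _] := Cf.
have st (x : K) : is_state (\val x : E -> R) by case: x => x /= /set_mem.
(* The coordinate [pone] is constantly 1 on states, so the barycentre condition fixes the total
   mass. *)
have nuT : mass setT = 1.
  have [_ s1 _] := st s; rewrite -[LHS]mul1r -cstE// -[RHS]s1 -nus.
  by apply: eq_Rintegral => x _; have [_ ->] := st x.
apply/ler_addgt0Pr => e e0.
have [|x _|us us_good usT] := compact_finite_cover s cK (D := good f e) (f := id).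
- by move=> U [].
- by have [U gU Ux] := good_nbhs x cf e0; exists U.
(* Discretisation of [nu] on [A], by induction on the cover: the piece of [A] in the first set
   becomes a point mass at its barycentre, and the rest is left to the other sets. *)
have disc (r : seq (set K)) : (forall U, U \in r -> good f e U) ->
  forall A : set (borel s), measurable A ->
    (forall x, A x -> exists2 U, U \in r & U x) ->
  exists l : seq (R * K), [/\ forall p, p \in l -> 0 <= p.1,
    \sum_(p <- l) p.1 = mass A,
    forall a, \sum_(p <- l) p.1 * \val p.2 a = \int[nu]_(x in A) \val (x : K) a &
    \int[nu]_(x in A) f x <= \sum_(p <- l) p.1 * f p.2 + e * mass A].
  elim: r => [_ A mA Ar|U r IH gr A mA Ar].
    have -> : A = set0 by apply/seteqP; split=> // x /Ar[].
    exists [::]; split; rewrite ?big_nil// /mass ?measure0// => *;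
      by rewrite ?big_nil ?Rintegral_set0// mulr0 addr0.
  have gU : good f e U by apply: gr; rewrite mem_head.
  have mU : measurable (U : set (borel s)).
    by apply: open_borel_measurable; case: gU.
  have mAU : measurable (A `&` U : set (borel s)) by exact: measurableI.
  have mAnU : measurable (A `\` U : set (borel s)) by exact: measurableD.
  have [V Vr|||l [l0 l1 lv lf]] := IH _ (A `\` U) => //.
  - by apply: gr; rewrite inE Vr orbT.
  - move=> x [Ax nUx]; have [V + Vx] := Ar x Ax.
    by rewrite inE => /predU1P[VU|Vr]; [rewrite VU in Vx|exists V].
  have AE : A = (A `&` U) `|` (A `\` U) by rewrite setUIDK.
  have dis : [disjoint A `&` U & A `\` U].
    by apply/disj_setPS => x [[_ Ux] [_ /(_ Ux)]].
  have splitI (g : K -> R) : continuous g -> \int[nu]_(x in A) g x =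
      \int[nu]_(x in A `&` U) g x + \int[nu]_(x in A `\` U) g x.
    move=> cg; rewrite {1}AE Rintegral_setU//.
    by apply: int_cont => //; exact: measurableU.
  have splitm : mass A = mass (A `&` U) + mass (A `\` U).
    by have := splitI (cst 1) (@cst_continuous _ _ _); rewrite !cstE// !mul1r.
  have mass0 : 0 <= mass (A `&` U) by apply: fine_ge0.
  (* A null piece cannot be averaged, but continuous functions integrate to 0 over it, so [l]
     already serves for [A]. *)
  move: mass0; rewrite le0r => /predU1P[m0|m0].
    have I0 (g : K -> R) : continuous g -> \int[nu]_(x in A `&` U) g x = 0.
      move=> cg; have [M gM] := continuous_bounded cK cg.
      have ic (c : R) : nu.-integrable (A `&` U) (EFin \o (cst c : K -> R)).
        by apply: int_cont => //; exact: cst_continuous.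
      have ub : \int[nu]_(x in A `&` U) g x <= \int[nu]_(x in A `&` U) M.
        apply: le_Rintegral => //; [exact: int_cont|exact: ic|move=> x _].
        by rewrite (le_trans (ler_norm _)).
      have lb : \int[nu]_(x in A `&` U) (- M) <= \int[nu]_(x in A `&` U) g x.
        apply: le_Rintegral => //; [exact: ic|exact: int_cont|move=> x _].
        by rewrite lerNl (le_trans (ler_norm _))// normrN.
      by move: ub lb; rewrite !cstE// m0 !mulr0 => ? ?; apply: le_anti; apply/andP.
    exists l; split => //.
    + by rewrite splitm m0 add0r.
    + by move=> a; rewrite splitI ?I0 ?add0r//; exact: state_coord_continuous.
    + by rewrite splitI// I0// add0r splitm m0 add0r.
  have [b bA] := barycentre_exists mAU m0.
  exists ((mass (A `&` U), b) :: l); split.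
  + by move=> p; rewrite inE => /predU1P[->/=|/l0//]; exact: ltW.
  + by rewrite big_cons l1 splitm.
  + move=> a; rewrite big_cons lv splitI ?bA//; exact: state_coord_continuous.
  + rewrite big_cons splitI//= splitm.
    have : \int[nu]_(x in A `&` U) f x <= (f b + e) * mass (A `&` U).
      rewrite -cstE//; apply: le_Rintegral => //; try exact: int_cont.
        by apply: int_cont => //; exact: cst_continuous.
      move=> x AUx; have [_ gUb] := gU.
      by apply: (gUb _ _ mAU _ m0 bA) => // z [].
    move=> fb; apply: (le_trans (lerD fb lf)).
    by rewrite le_eqVlt; apply/orP; left; apply/eqP; ring.
(* On the whole space the discretisation is a convex combination representing [s], which the
   envelope bounds. *)
have [|//||l [l0 l1 lv lf]] := disc (finmap.enum_fset us) _ setT.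
- by move=> U Uus; have := us_good U Uus; rewrite inE.
- by move=> x _; have [U Uus Ux] := usT x I; exists U.
move: lf; rewrite nuT mulr1 => /le_trans; apply; rewrite lerD2r.
apply: concave_envelope_ub; first exact: convex_continuous_bounded.
split => //; first by rewrite l1.
apply/funext => a; rewrite -nus -lv.
elim: {l0 l1 lv} l => [|p l IH]; first by rewrite !big_nil.
by rewrite !big_cons -IH.
Qed.

End barycentre.

(** * The representing measure *)

Section restriction.
Variables (R : realType) (E : effectAlgType).
Local Notation V := {ptws E -> R^o}.
Local Notation K := (state_space R E).
Local Open Scope convex_scope.

Lemma state_space_val (x : K) : K (\val x).
Proof. by case: x => x /= /set_mem. Qed.

Lemma restriction_convex_continuous (f : V -> R^o) :
  {within K, continuous f} -> convex_function K f ->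
  convex_continuous (fun x : K => f (\val x) : R).
Proof.
move=> /subspace_sigL_continuousP cf vf; split=> [|x y z t /andP[t0 t1] zE].
  exact: cf.
rewrite zE; apply: (vf (Itv01 t0 t1)); exact/mem_set/state_space_val.
Qed.

(** Needed because [mprec] tests functions on the whole space. Its conditions concern [K] only, so
    extension by 0 suffices. *)
Lemma extension_convex_continuous (g : K -> R) :
  convex_set (K : set (convex_lmodType V)) -> convex_continuous g ->
  exists f : V -> R^o, [/\ {within K, continuous f}, convex_function K f &
    forall x : K, f (\val x) = g x].
Proof.
move=> sK [cg vg]; pose f := valL_ (0 : R^o) (g : K -> R^o).
have fE (x : K) : f (\val x) = g x.
  exact: (congr1 (fun k => k x) (@valLK _ _ (0 : R^o) K g)).
exists f; split => //; first exact/subspace_valL_continuousP'.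
move=> t x y xK yK.
have zK := sK x y t xK yK.
have := vg (exist _ x xK) (exist _ y yK) (exist _ (x <| t |> y) zK) t%:num.
rewrite -!fE; apply => //.
by rewrite ge0 le1.
Qed.

(** Used with [c] equal to 1 and -1: an affine function and its opposite are both convex. *)
Lemma restriction_affine (f : V -> R^o) (c : R) :
  {within K, continuous f} -> affine_on K f ->
  convex_continuous (fun x : K => c * f (\val x)).
Proof.
move=> /subspace_sigL_continuousP cf af; split=> [|x y z t /andP[t0 t1] zE].
  exact: (@real_continuousZ R K c (fun x : K => f (\val x)) cf).
have := af (Itv01 t0 t1) _ _ (mem_set (state_space_val x))
  (mem_set (state_space_val y)).
rewrite -[LHS]/(f (t *: \val x + (1 - t) *: \val y)) -zE => ->.
rewrite -[leLHS]/(c * (t * f (\val x) + (1 - t) * f (\val y))).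
by rewrite mulrDr (mulrCA c t) (mulrCA c (1 - t)).
Qed.

Lemma coord_convex_continuous (a : E) (c : R) :
  convex_continuous (fun x : K => c * \val x a).
Proof.
split=> [|x y z t _ ->].
  by apply: real_continuousZ; exact: state_coord_continuous.
rewrite -[leLHS]/(c * (t * \val x a + (1 - t) * \val y a)).
by rewrite mulrDr (mulrCA c t) (mulrCA c (1 - t)).
Qed.

End restriction.

(** * The maximal measure with barycentre s *)

Section choquet_measure.
Variables (R : realType) (E : effectAlgType).
Local Notation K := (state_space R E).
Hypothesis S_simplex : simplex (state_space R E).
Variable s : K.
Local Open Scope ereal_scope.

Let cK : compact [set: K].
Proof. exact: compact_subtype (@state_space_compact R E). Qed.

Lemma continuous_integralE (nu : {finite_measure set (borel s) -> \bar R}) (f : K -> R) :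
  continuous f -> \int[nu]_x (f x)%:E = (\int[nu]_x f x)%R%:E.
Proof.
move=> cf; rewrite /Rintegral fineK//; apply: integrable_fin_num => //.
exact: continuous_integrable.
Qed.

Lemma integral_le_envelope (nu : {finite_measure set (borel s) -> \bar R})
    (f : K -> R) :
  (forall a, \int[nu]_x (\val (x : K) a)%:E = (\val s a)%:E) ->
  convex_continuous f -> \int[nu]_x (f x)%:E <= (concave_envelope f s)%:E.
Proof.
move=> nus Cf; have [cf _] := Cf; rewrite continuous_integralE// lee_fin.
apply: le_concave_envelope_integral => // a.
by apply: EFin_inj; rewrite -nus continuous_integralE//; exact: state_coord_continuous.
Qed.

Lemma choquet_measure_exists : exists mu : probability (borel s) R,
  regular_measure mu /\ forall f, convex_continuous f ->
    \int[mu]_x (f x)%:E = (concave_envelope f s)%:E.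
Proof.
have [mu [rmu muI]] := riesz_representation s cK
  (@convex_difference_lattice R E) (envelope_functional_positive S_simplex s).
exists mu; split => // f Cf.
have C0 := convex_continuous_cst E (0 : R)%R.
have fE : f = (fun x => f x - cst 0 x)%R by apply/funext => x; rewrite subr0.
rewrite {1}fE muI; last by exists f, (cst 0%R).
by rewrite envelope_functionalE// concave_envelope_cst subr0.
Qed.

(** Additivity makes the envelopes of [f] and [- f] at [s] sum to 0, while they are at least [f s]
    and [- f s]; so both bounds are equalities. *)
Lemma concave_envelope_affine (f : K -> R) : convex_continuous f ->
  convex_continuous (fun x => - f x)%R -> concave_envelope f s = f s.
Proof.
move=> Cf Cf'; have [bf bf'] := (convex_continuous_bounded Cf,
  convex_continuous_bounded Cf').
apply/eqP; rewrite eq_le concave_envelope_ge// andbT.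
have := concave_envelope_ge s bf'.
have : (concave_envelope (fun x => f x + - f x)%R s = 0)%R.
  rewrite -[RHS](concave_envelope_cst 0%R s); congr concave_envelope.
  by apply/funext => x; rewrite subrr.
rewrite concave_envelope_simplexD//; [lra|by case: Cf|by case: Cf'].
Qed.

Lemma concave_envelope_coord (a : E) (c : R) :
  concave_envelope (fun x : K => c * \val x a)%R s = (c * \val s a)%R.
Proof.
apply: concave_envelope_affine; first exact: coord_convex_continuous.
rewrite (_ : (fun _ => _) = fun x : K => (- c * \val x a)%R).
  exact: coord_convex_continuous.
by apply/funext => x; rewrite mulNr.
Qed.

Variable mu : probability (borel s) R.
Hypothesis rmu : regular_measure mu.
Hypothesis muE : forall f, convex_continuous f ->
  \int[mu]_x (f x)%:E = (concave_envelope f s)%:E.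

Lemma choquet_measure_coord (a : E) :
  \int[mu]_x (\val (x : K) a)%:E = (\val s a)%:E.
Proof.
have := muE (coord_convex_continuous a 1%R).
rewrite concave_envelope_coord mul1r => <-.
by apply: eq_integral => x _; rewrite mul1r.
Qed.

Lemma choquet_measure_msim : msim mu (\d_(s : borel s)).
Proof.
move=> f cf af.
have C1 := restriction_affine 1%R cf af.
have CN1 := restriction_affine (-1)%R cf af.
have E1 : (fun x : K => 1 * f (\val x))%R = (fun x : K => f (\val x)).
  by apply/funext => x; rewrite mul1r.
have EN1 : (fun x : K => -1 * f (\val x))%R = (fun x : K => - f (\val x))%R.
  by apply/funext => x; rewrite mulN1r.
rewrite E1 in C1; rewrite EN1 in CN1.
rewrite (muE C1) concave_envelope_affine//.
have [c1 _] := C1.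
rewrite integral_dirac ?diracT ?mul1e//.
by apply/measurable_realfun.measurable_EFinP; exact: continuous_borel_measurable.
Qed.

Lemma mprec_choquet_measure_le (lambda : {finite_measure set (borel s) -> \bar R}) f :
  mprec mu lambda -> convex_continuous f ->
  (concave_envelope f s)%:E <= \int[lambda]_x (f x)%:E.
Proof.
move=> mulambda Cf; have [g [cg vg gE]] := extension_convex_continuous S_simplex.1 Cf.
rewrite -muE// (_ : f = fun x : K => g (\val x)); first exact: mulambda.
by apply/funext => x; rewrite gE.
Qed.

(** A measure [lambda] above [mu] also has barycentre [s], so the envelope bounds its integrals of
    convex functions. It thus agrees with [mu] on these, hence on their differences, and regularity
    does the rest. *)
Lemma choquet_measure_maximal : maximal_measure mu.
Proof.
move=> lambda rlambda mulambda.
have le_lambda f := @mprec_choquet_measure_le lambda f mulambda.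
(* Both signs of a coordinate are convex, so lying above [mu] fixes the coordinate integrals of
   [lambda]. *)
have coords a : \int[lambda]_x (\val (x : K) a)%:E = (\val s a)%:E.
  have cc := @state_coord_continuous R E a.
  have le_coord c : (c * \val s a <= c * \int[lambda]_x \val (x : K) a)%R.
    have := le_lambda _ (coord_convex_continuous a c).
    rewrite concave_envelope_coord continuous_integralE ?lee_fin; last first.
      exact: real_continuousZ.
    by rewrite RintegralZl//; exact: continuous_integrable.
  rewrite continuous_integralE//; congr EFin; apply/eqP; rewrite eq_le.
  by have := le_coord 1%R; have := le_coord (-1)%R; lra.
have lambdaE f : convex_continuous f ->
    \int[lambda]_x (f x)%:E = \int[mu]_x (f x)%:E.
  move=> Cf; apply/eqP; rewrite eq_le muE// le_lambda// andbT.
  exact: integral_le_envelope.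
have UL := @convex_difference_lattice R E.
apply: (regular_measure_eq cK UL rmu rlambda) => _ [f [g [Cf Cg ->]]].
have := lambdaE _ Cf; have := lambdaE _ Cg.
have [[cf _] [cg _]] := (Cf, Cg).
rewrite !continuous_integralE//; try exact: real_continuousB.
move=> [gE] [fE]; congr EFin.
by rewrite !RintegralB// ?fE ?gE//; exact: continuous_integrable.
Qed.

End choquet_measure.

Local Open Scope ereal_scope.

Theorem theorem6p3 (R : realType) (E : effectAlgType)
    (E_interval : interval_effect_algebra E)
    (S_simplex : simplex (state_space R E))
    (s : state_space R E) :
  let is_mu_s (mu : probability (borel s) R) : Prop :=
    [/\ regular_measure mu,
        maximal_measure mu,
        msim mu (\d_(s : borel s)) &
        forall a : E,
          (\val s a)%:E = \int[mu]_x (\val (x : state_space R E) a)%:E] in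
  exists mu : probability (borel s) R,
    is_mu_s mu /\
    forall nu : probability (borel s) R, is_mu_s nu -> meq nu mu.
Proof.
move=> is_mu_s.
have [mu [rmu muE]] := choquet_measure_exists S_simplex s.
exists mu; split.
  split => //.
  - exact: choquet_measure_maximal.
  - exact: choquet_measure_msim.
  - by move=> a; rewrite choquet_measure_coord.
(* The envelope bound puts every such [nu] below [mu], so the maximality of [nu] itself forces
   equality. *)
move=> nu [rnu maxnu _ coords] A mA; symmetry; apply: maxnu => //.
move=> f cf vf; have Cf := restriction_convex_continuous cf vf.
rewrite (muE _ Cf); exact: integral_le_envelope.
Qed.
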